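(* The space $B^0_{\infty,1}(\mathbb{R})$ is not a Banach algebra under pointwise multiplication. That is, there is no constant $C>0$ such that $$\|fg\|_{B^0_{\infty,1}}\le C\|f\|_{B^0_{\infty,1}}\|g\|_{B^0_{\infty,1}}\quad\text{for all } f,g\in B^0_{\infty,1}(\mathbb{R})$$ (with $\|fg\|_{B^0_{\infty,1}}=\infty$ if $fg\notin B^0_{\infty,1}(\mathbb{R})$).
   Context: Littlewood-Paley blocks: fix radial smooth functions $\chi,\varphi:\mathbb{R}\to[0,1]$ with $\chi$ supported in $\{|\xi|\le \frac43\}$, $\varphi$ supported in $\{\frac34\le|\xi|\le\frac83\}$, and $\chi(\xi)+\sum_{j\ge0}\varphi(2^{-j}\xi)=1$ for all $\xi$. For a tempered distribution $u$ put $\Delta_{-1}u=\mathcal{F}^{-1}(\chi\mathcal{F}u)$ and $\Delta_j u=\mathcal{F}^{-1}(\varphi(2^{-j}\cdot)\mathcal{F}u)$ for $j\ge0$. The space $B^0_{\infty,1}(\mathbb{R})$ consists of the tempered distributions $u$ with $\|u\|_{B^0_{\infty,1}}=\sum_{j\ge-1}\|\Delta_ju\|_{L^\infty}<\infty$. It embeds continuously into $L^\infty(\mathbb{R})$, so pointwise products of its elements are well defined. *)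

(* Defs.v *)
From HB Require Import structures.
From mathcomp Require Import all_boot all_order all_algebra.
From mathcomp Require Import all_classical all_reals all_analysis.
From mathcomp Require Import complex.

Set Implicit Arguments.
Unset Strict Implicit.
Unset Printing Implicit Defensive.
Import Order.TTheory GRing.Theory Num.Theory.
Import numFieldNormedType.Exports.
Local Open Scope classical_set_scope.
Local Open Scope ring_scope.
Local Open Scope complex_scope.

Section Besov.
Context {R : realType}.
Local Notation mu := (@lebesgue_measure R).
Implicit Types (psi F G : R -> R[i]) (m chi phi : R -> R).

Definition smooth (f : R -> R) : Prop := forall n x, derivable (derive1n n f) x 1.

(* R[i] is not a normed space over R in the library, so differentiation and
   integration of complex-valued functions of a real variable go through the
   real and imaginary parts. *)
Definition cderiv (n : nat) psi : R -> R[i] := fun x =>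
  derive1n n (fun t => complex.Re (psi t)) x +i* derive1n n (fun t => complex.Im (psi t)) x.

Definition cintegral psi : R[i] :=
  (\int[mu]_x complex.Re (psi x)) +i* (\int[mu]_x complex.Im (psi x)).

Definition schwartz psi : Prop :=
  [/\ smooth (fun x => complex.Re (psi x)), smooth (fun x => complex.Im (psi x)) &
      forall k n : nat, exists M : R,
        forall x, `|x| ^+ k * Normc.normc (cderiv n psi x) <= M].

Definition schwartz_norm (N : nat) psi : R :=
  \sum_(k < N.+1) \sum_(n < N.+1)
    sup (range (fun x : R => `|x| ^+ k * Normc.normc (cderiv n psi x))).

(* A distribution is applied to Schwartz functions only; its values on other
   functions are irrelevant and play no role below. *)
Definition distr := (R -> R[i]) -> R[i].

Definition tempered (u : distr) : Prop :=
  (forall (a : R[i]) psi1 psi2, schwartz psi1 -> schwartz psi2 ->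
     u (fun x => a * psi1 x + psi2 x) = a * u psi1 + u psi2) /\
  (exists (N : nat) (K : R), forall psi, schwartz psi ->
     Normc.normc (u psi) <= K * schwartz_norm N psi).

Definition fourier psi : R -> R[i] := fun xi =>
  cintegral (fun x => (cos (x * xi) -i* sin (x * xi)) * psi x).

Definition inv_fourier psi : R -> R[i] := fun x =>
  ((2 * pi)^-1)%:C *
  cintegral (fun xi => (cos (x * xi) +i* sin (x * xi)) * psi xi).

Definition distr_fourier (u : distr) : distr :=
  fun psi => u (fourier psi).

Definition distr_inv_fourier (u : distr) : distr :=
  fun psi => u (inv_fourier psi).

Definition distr_mul m (u : distr) : distr :=
  fun psi => u (fun x => (m x)%:C * psi x).

Definition multiplier m (u : distr) : distr :=
  distr_inv_fourier (distr_mul m (distr_fourier u)).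

Definition littlewood_paley_pair chi phi : Prop :=
  [/\ smooth chi /\ smooth phi,
      (forall xi, chi (- xi) = chi xi) /\ (forall xi, phi (- xi) = phi xi),
      (forall xi, 0 <= chi xi <= 1) /\ (forall xi, 0 <= phi xi <= 1),
      (forall xi, chi xi != 0 -> `|xi| <= 4 / 3) /\
      (forall xi, phi xi != 0 -> 3 / 4 <= `|xi| <= 8 / 3) &
      forall xi, ((chi xi)%:E +
        \sum_(0 <= j <oo) (phi (2 ^- j * xi))%:E)%E = 1%:E].

Definition lowfreq_block chi (u : distr) : distr :=
  multiplier chi u.

Definition dyadic_block phi (j : nat) (u : distr) : distr :=
  multiplier (fun xi => phi (2 ^- j * xi)) u.

Definition distr_of F : distr :=
  fun psi => cintegral (fun x => F x * psi x).

Definition Linfty_fnorm F : \bar R :=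
  ('N[mu]_+oo [ EFin \o (@Normc.normc R) \o F ])%E.

Definition Linfty F : Prop :=
  [/\ measurable_fun setT (fun x => complex.Re (F x)),
      measurable_fun setT (fun x => complex.Im (F x)) & (Linfty_fnorm F < +oo)%E].

Definition represents F (u : distr) : Prop :=
  Linfty F /\ forall psi, schwartz psi -> u psi = distr_of F psi.

(* Representatives agree almost everywhere, so the infimum is over at most one
   value; it is +oo when u is not an essentially bounded function. *)
Definition Linfty_norm (u : distr) : \bar R :=
  ereal_inf [set Linfty_fnorm F | F in [set F | represents F u]].

Definition besov_norm chi phi (u : distr) : \bar R :=
  (Linfty_norm (lowfreq_block chi u) +
   \sum_(0 <= j <oo) Linfty_norm (dyadic_block phi j u))%E.

Definition besov chi phi (u : distr) : Prop :=
  tempered u /\ (besov_norm chi phi u < +oo)%E.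

(* Elements of the Besov space are essentially bounded functions; w is the
   distribution given by the almost-everywhere product of u and v. *)
Definition pointwise_product (u v w : distr) : Prop :=
  exists F G, [/\ represents F u, represents G v &
                  w = distr_of (fun x => F x * G x)].

End Besov.

Arguments distr R : clear implicits.

(* Main.v *)
Require Import Defs.
From HB Require Import structures.
From mathcomp Require Import all_boot all_order all_algebra.
From mathcomp Require Import all_classical all_reals all_analysis.
From mathcomp Require Import measurable_realfun ess_sup_inf.
From mathcomp Require Import complex.
From mathcomp Require Import ring lra.
Import Order.TTheory GRing.Theory Num.Theory.
Import numFieldNormedType.Exports.
Local Open Scope ring_scope.

(** A product can move frequencies from one dyadic block to many.  On the shell
    4/3 2^j < |xi| < 3/2 2^j one has phi (2^-j xi) = 1 while all other cut-offs
    vanish, so for a trigonometric polynomial f with spectrum in such a shell the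
    Besov norm is at most sup |f|.  Take the Riesz product
    h = prod_(j < N) (1 + i a cos (M_j x)) with M_j = 17/12 2^(5j), a = 1/n and
    N = n^2.  Then |h| <= prod (1 + a^2) <= e, and h = 1 + sum_j P_j where
    P_j = i a cos (M_j x) prod_(i < j) (1 + i a cos (M_i x)) has spectrum in the
    shell of index 5j, so that P_j is the block of h of index 5j, and
    |P_j(0)| >= a.  Hence h has Besov norm at least of order N a = n, although it is the
    product of e^(i M_N x) h and e^(-i M_N x), whose norms are at most e and 1.

    That a multiplier m acts on e^(i l x) as multiplication by m(l) amounts to
    Fourier inversion for m: two applications of Fubini turn the multiplier into
    convolution with K(z) = (2 pi)^-1 int cos (z xi) m(xi) dxi, which decays like
    1/(1 + z^2), and int cos (l z) K(z) dz = m(l) follows by inserting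
    e^(-eps |z|), whose cosine transform is a Poisson kernel. *)

Set Implicit Arguments.
Unset Strict Implicit.
Unset Printing Implicit Defensive.
Local Open Scope classical_set_scope.
Local Open Scope complex_scope.

(** * Integrals of real functions *)

Section real_integrals.
Context {R : realType}.
Local Notation mu := (@lebesgue_measure R).
Implicit Types f g : R -> R.

Definition L1 f := mu.-integrable [set: R] (EFin \o f).

Lemma L1_measurable f : L1 f -> measurable_fun [set: R] f.
Proof. by move=> /measurable_int /measurable_EFinP. Qed.

Lemma L1_le f g : measurable_fun [set: R] f -> L1 g ->
  (forall x, `|f x| <= g x) -> L1 f.
Proof.
move=> mf ig fg; apply: le_integrable ig => //; first exact/measurable_EFinP.
by move=> x _ /=; rewrite lee_fin (le_trans (fg x)) ?ler_norm.
Qed.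

Lemma L1D f g : L1 f -> L1 g -> L1 (fun x => f x + g x).
Proof. by move=> fi gi; have := integrableD measurableT fi gi. Qed.

Lemma L1Zl (k : R) f : L1 f -> L1 (fun x => k * f x).
Proof. by move=> fi; have := integrableZl measurableT k fi. Qed.

Lemma L1_norm f : L1 f -> L1 (fun x => `|f x|).
Proof. by move=> /integrable_abse. Qed.

Lemma L1_bounded_mul (B : R) f g : measurable_fun [set: R] f ->
  (forall x, `|f x| <= B) -> L1 g -> L1 (fun x => f x * g x).
Proof.
move=> mf fB ig; apply: (@L1_le _ (fun x => B * `|g x|)).
- by apply: measurable_funM => //; exact: L1_measurable.
- by apply: L1Zl; exact: L1_norm.
- by move=> x; rewrite normrM ler_wpM2r.
Qed.

Lemma L1_compact f (A : R) : continuous f -> (forall x, A < `|x| -> f x = 0) -> L1 f.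
Proof.
move=> cf f0.
have mI : measurable (`[- A, A]%classic : set R) by exact: measurable_itv.
have : mu.-integrable `[- A, A] (EFin \o f).
  by apply: continuous_compact_integrable;
    [exact: segment_compact|exact: continuous_subspaceT].
rewrite -{1}(setTI `[- A, A]%classic) => /integrable_restrict => /(_ mI measurableT).
apply: eq_integrable => //= x _; rewrite patchE; case: ifPn => // /negP xA.
rewrite /= f0 // ltNge; apply/negP; rewrite ler_norml => h; apply: xA.
by rewrite inE /= in_itv.
Qed.

Lemma RintE f : L1 f -> (\int[mu]_x f x)%:E = (\int[mu]_x (f x)%:E)%E.
Proof. by move=> fi; rewrite /Rintegral fineK // integrable_fin_num. Qed.

(** Split the line at 0; the substitution x -> -x exchanges the two half-lines. Nonnegativity allows
    the splitting in the extended reals without integrability. *)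
Lemma ge0_integral_opp f : continuous f -> (forall x, 0 <= f x) ->
  (\int[mu]_x (f (- x))%:E = \int[mu]_x (f x)%:E)%E.
Proof.
have split_int g : continuous g -> (forall x, 0 <= g x) ->
  (\int[mu]_x (g x)%:E = \int[mu]_(x in `[0%R, +oo[) (g x)%:E +
     \int[mu]_(x in `[0%R, +oo[) (g (- x))%:E)%E.
  move=> cg g0.
  have mg : measurable_fun [set: R] g by exact: continuous_measurable_fun.
  rewrite -(setUv `[0%R : R, +oo[%classic) ge0_integral_setU//=; last 4 first.
  - exact: measurableC.
  - by rewrite setUv; exact/measurable_EFinP.
  - by move=> x _; rewrite lee_fin.
  - exact/disj_setPCl.
  congr (_ + _)%E.
  rewrite setCitvr integral_itv_bndo_bndc; last exact/measurable_EFinP/measurable_funTS.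
  rewrite -{1}oppr0 ge0_integration_by_substitutionNy// oppr0.
  exact: continuous_subspaceT.
move=> cf f0; rewrite (split_int f)// (split_int (fun x => f (- x))).
- by rewrite addeC; congr (_ + _)%E; apply: eq_integral => x _; rewrite opprK.
- move=> x; apply: continuous_comp; [exact: oppr_continuous|exact: cf].
- by move=> x.
Qed.

Lemma ge0_integral_affine f (a c : R) : continuous f -> (forall x, 0 <= f x) -> 0 < c ->
  (\int[mu]_x (f (a + c * x) * c)%:E = \int[mu]_x (f x)%:E)%E.
Proof.
move=> cf f0 c0.
have dF (x : R) : is_derive x 1 (fun x => a + c * x) c.
  by apply: is_derive_eq; rewrite /GRing.scale /=; ring.
have d1F : derive1 (fun x : R => a + c * x) = cst c.
  by apply/funext => x; rewrite derive1E; apply: derive_val.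
rewrite [RHS](@increasing_ge0_integration_by_substitutionT _ (fun x => a + c * x)) //.
- by apply: eq_integral => x _; rewrite d1F.
- by move=> x y xy; rewrite ltrD2l ltr_pM2l.
- by rewrite d1F; move=> x; exact: cst_continuous.
- by rewrite d1F; exact: is_cvg_cst.
- by rewrite d1F; exact: is_cvg_cst.
- apply/cvgrNyPle => M; near=> x.
  have : x <= (M - a) / c by near: x; apply: nbhs_ninfty_le; rewrite num_real.
  by rewrite ler_pdivlMr // => ?; lra.
- apply/cvgryPge => M; near=> x.
  have : x >= (M - a) / c by near: x; apply: nbhs_pinfty_ge; rewrite num_real.
  by rewrite ler_pdivrMr // => ?; lra.
Unshelve. all: by end_near. Qed.

Let funpos_cont f : continuous f -> continuous (fun x => Num.max (f x) 0).
Proof.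
move=> cf x; apply: (@continuous_max _ _ f (cst 0) x); first exact: cf.
exact: cst_continuous.
Qed.

(** This reduces a change of variables for an arbitrary continuous function to the nonnegative case,
    with no integrability required: each of the two extended integrals is transformed separately. *)
Lemma integral_pos_neg f : (\int[mu]_x (f x)%:E =
  \int[mu]_x (Num.max (f x) 0)%:E - \int[mu]_x (Num.max (- f x) 0)%:E)%E.
Proof.
rewrite integralE; congr (_ - _)%E; apply: eq_integral => x _.
  by rewrite funeposE /= EFin_max.
by rewrite funenegE /= EFin_max.
Qed.

Lemma Rintegral_opp f : continuous f ->
  \int[mu]_x f (- x) = \int[mu]_x f x.
Proof.
move=> cf; rewrite /Rintegral; congr fine.
rewrite integral_pos_neg [RHS]integral_pos_neg; congr (_ - _)%E.
  apply: (@ge0_integral_opp (fun x => Num.max (f x) 0)).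
    exact: funpos_cont.
  by move=> x; rewrite le_max lexx orbT.
apply: (@ge0_integral_opp (fun x => Num.max (- f x) 0)).
  by apply: funpos_cont => x; apply: cvgN; exact: cf.
by move=> x; rewrite le_max lexx orbT.
Qed.

Lemma Rintegral_affine f (a c : R) : continuous f -> 0 < c ->
  \int[mu]_x (f (a + c * x) * c) = \int[mu]_x f x.
Proof.
move=> cf c0; rewrite /Rintegral; congr fine.
rewrite integral_pos_neg [RHS]integral_pos_neg; congr (_ - _)%E.
  rewrite -(@ge0_integral_affine (fun x => Num.max (f x) 0) a c) //.
  - by apply: eq_integral => x _; rewrite maxr_pMl ?ltW // mul0r.
  - exact: funpos_cont.
  - by move=> x; rewrite le_max lexx orbT.
rewrite -(@ge0_integral_affine (fun x => Num.max (- f x) 0) a c) //.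
- by apply: eq_integral => x _; rewrite maxr_pMl ?ltW // mul0r mulNr.
- by apply: funpos_cont => x; apply: cvgN; exact: cf.
- by move=> x; rewrite le_max lexx orbT.
Qed.

Lemma Rintegral_shift f (a : R) : continuous f ->
  \int[mu]_x f (a + x) = \int[mu]_x f x.
Proof.
move=> cf; rewrite -(@Rintegral_affine f a 1) //; apply: eq_Rintegral => x _.
by rewrite mul1r mulr1.
Qed.

Lemma RintegralN f : \int[mu]_x (- f x) = - \int[mu]_x f x.
Proof.
rewrite /Rintegral.
rewrite integral_pos_neg [in RHS]integral_pos_neg.
under [in X in fine (_ - X)]eq_integral do rewrite opprK.
(* [fine] sends every infinite value to 0, including that of +oo - +oo, so both sides are 0 unless
   both integrals are finite. *)
rewrite -fineN; case: (\int[mu]_x _)%E => [a| |]; case: (\int[mu]_x _)%E => [b| |] //=.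
by rewrite opprB.
Qed.

Lemma Rintegral_odd f : continuous f -> (forall x, f (- x) = - f x) ->
  \int[mu]_x f x = 0.
Proof.
move=> cf of_; have := Rintegral_opp cf.
under eq_Rintegral do rewrite of_.
rewrite RintegralN => h; lra.
Qed.

(** * Exchange of integrals under a majorant that is a product *)

Section Fubini_dominated.
Variables (f : R -> R -> R) (a b : R -> R).
Hypothesis mf : measurable_fun [set: R * R] (fun p => f p.1 p.2).
Hypothesis (ia : L1 a) (ib : L1 b) (fab : forall x y, `|f x y| <= a x * b y).

Lemma dominated_L1_right x : L1 (f x).
Proof.
apply: (@L1_le _ (fun y => a x * b y)) => //; last exact: L1Zl.
exact: (measurableT_comp mf (measurable_pair1 x)).
Qed.

Lemma dominated_L1_left y : L1 (f ^~ y).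
Proof.
apply: (@L1_le _ (fun x => b y * a x)) => //; last by move=> x; rewrite mulrC.
  exact: (measurableT_comp mf (measurable_pair2 y)).
exact: L1Zl.
Qed.

Let ifab : (mu \x mu)%E.-integrable setT (fun p : R * R => (f p.1 p.2)%:E).
Proof.
apply/integrable12ltyP => /=; first exact/measurable_EFinP.
have ge x y : 0 <= a x * b y by apply: le_trans (fab x y).
(* Only the products [a x * b y] are known to be nonnegative, so the majorant for Tonelli is built
   from absolute values. *)
apply: (@le_lt_trans _ _ (\int[mu]_x (`|a x| * \int[mu]_y `|b y|)%:E)%E).
  apply: ge0_le_integral => //.
  - by move=> x _; exact: integral_ge0.
  - apply: (measurable_fun_fubini_tonelli_F (m2 := mu) (fun p : R * R => `|f p.1 p.2|%:E)%E).
      by apply/measurable_EFinP; exact: measurableT_comp.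
    by move=> p; rewrite lee_fin.
  - apply/measurable_EFinP; apply: measurable_funM => //.
    by apply: measurableT_comp => //; exact: L1_measurable.
  move=> x _; rewrite EFinM RintE ?L1_norm//.
  rewrite -ge0_integralZl ?lee_fin //; last first.
    by apply/measurable_EFinP; exact: L1_measurable (L1_norm ib).
  apply: ge0_le_integral => //.
  - by apply/measurable_EFinP; exact: L1_measurable (L1_norm (dominated_L1_right x)).
  - apply/measurable_EFinP; apply: measurable_funM => //.
    exact: L1_measurable (L1_norm ib).
  - move=> y _; rewrite -EFinM lee_fin (le_trans (fab x y)) //.
    by rewrite (le_trans (ler_norm _)) // normrM.
have /integrableP[_] := L1Zl (\int[mu]_y `|b y|) (L1_norm ia).
apply: le_lt_trans; rewrite le_eqVlt; apply/orP; left; apply/eqP.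
apply: eq_integral => x _ /=; rewrite normrM normr_id mulrC.
by congr (_ * _)%:E; apply/esym/ger0_norm/Rintegral_ge0 => y _.
Qed.

Lemma dominated_Fubini :
  \int[mu]_x \int[mu]_y f x y = \int[mu]_y \int[mu]_x f x y.
Proof.
suff E : (\int[mu]_x (\int[mu]_y f x y)%:E = \int[mu]_y (\int[mu]_x f x y)%:E)%E.
  by rewrite {1}/Rintegral E.
transitivity (\int[mu]_x \int[mu]_y (f x y)%:E)%E.
  by apply: eq_integral => x _; rewrite RintE //; exact: dominated_L1_right.
rewrite (Fubini ifab) /=; apply: eq_integral => y _.
by rewrite RintE //; exact: dominated_L1_left.
Qed.



End Fubini_dominated.

End real_integrals.

(** * Calculus for compactly supported functions, dominated convergence, and the Poisson weight *)

Section calculus.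
Context {R : realType}.
Local Notation mu := (@lebesgue_measure R).
Implicit Types f g : R -> R.

Lemma is_derive_continuous f (x d : R) : is_derive x 1 f d -> {for x, continuous f}.
Proof. by move=> [/derivable1_diffP /differentiable_continuous]. Qed.

Lemma is_derive_scale (z x : R) : is_derive x 1 (fun x => z * x) z.
Proof. by apply: is_derive_eq; rewrite /GRing.scale /=; ring. Qed.

Lemma is_derive_cosM (z x : R) :
  is_derive x 1 (fun x => cos (z * x)) (- z * sin (z * x)).
Proof.
have := is_derive1_comp (is_derive_cos (z * x)) (is_derive_scale z x).
by rewrite mulrC mulrN -mulNr.
Qed.

Lemma is_derive_sinM (z x : R) :
  is_derive x 1 (fun x => sin (z * x)) (z * cos (z * x)).
Proof.
have := is_derive1_comp (is_derive_sin (z * x)) (is_derive_scale z x).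
by rewrite mulrC.
Qed.

Lemma is_derive_expM (z x : R) :
  is_derive x 1 (fun x => expR (z * x)) (z * expR (z * x)).
Proof.
have := is_derive1_comp (is_derive_expR (z * x)) (is_derive_scale z x).
by rewrite mulrC.
Qed.

Lemma continuous_cosM (z : R) : continuous (fun x => cos (z * x)).
Proof. by move=> x; apply: is_derive_continuous (is_derive_cosM z x). Qed.

Lemma continuous_sinM (z : R) : continuous (fun x => sin (z * x)).
Proof. by move=> x; apply: is_derive_continuous (is_derive_sinM z x). Qed.

Lemma continuousMf f g : continuous f -> continuous g -> continuous (fun x => f x * g x).
Proof. by move=> cf cg x; apply: cvgM; [exact: cf|exact: cg]. Qed.

Lemma continuousDf f g : continuous f -> continuous g -> continuous (fun x => f x + g x).
Proof. by move=> cf cg x; apply: cvgD; [exact: cf|exact: cg]. Qed.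

Lemma continuous_affine f (a c : R) : continuous f -> continuous (fun x => f (a + c * x)).
Proof.
move=> cf x; apply: (@continuous_comp _ _ _ (fun x => a + c * x) f); last exact: cf.
apply: cvgD; first exact: cvg_cst.
by apply: cvgMl_tmp; exact: cvg_id.
Qed.

(** The strict inequality makes the region of vanishing open, so derivatives vanish on the same
    region. *)
Definition vanishes_beyond (A : R) f := forall x, A < `|x| -> f x = 0.

Lemma vanishes_near (A x : R) f : vanishes_beyond A f -> A < `|x| ->
  \forall y \near x, f y = 0.
Proof.
move=> f0 Ax; near=> y; apply: f0; near: y.
have : `|y| @[y --> x] --> `|x| by exact: norm_continuous.
by move/cvgrPdist_lt => /(_ (`|x| - A)); rewrite subr_gt0 => /(_ Ax); apply: filterS => y /=;
  rewrite ltr_norml => /andP[_]; rewrite ltrBlDr -ltrBlDl opprB addrC subrK.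
Unshelve. all: by end_near. Qed.

Lemma is_derive_vanishes (A : R) f g : vanishes_beyond A f ->
  (forall x : R, is_derive x 1 f (g x)) -> vanishes_beyond A g.
Proof.
move=> f0 df x Ax.
have h : is_derive x 1 f 0.
  apply: (@near_eq_is_derive _ _ _ (cst 0 : R -> R)).
    by apply: filterS (vanishes_near f0 Ax) => y ->.
by have [_ <-] := df x; have [_ ->] := h.
Qed.

Lemma vanishesM (A : R) f g : vanishes_beyond A g -> vanishes_beyond A (fun x => f x * g x).
Proof. by move=> g0 x Ax; rewrite g0 // mulr0. Qed.

Lemma vanishesD (A : R) f g : vanishes_beyond A f -> vanishes_beyond A g ->
  vanishes_beyond A (fun x => f x + g x).
Proof. by move=> f0 g0 x Ax; rewrite f0 // g0 // addr0. Qed.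

Lemma vanishes_bounded (A : R) f : continuous f -> vanishes_beyond A f ->
  exists B, forall x, `|f x| <= B.
Proof.
(* Taking the maximum with 0 keeps [-B, B] nonempty when [A] is negative. *)
move=> cf f0; pose B := Num.max A 0.
have B0 : - B <= B by rewrite ge0_cp // /B le_max lexx orbT.
have cn : continuous (fun x => `|f x|).
  by move=> x; apply: continuous_comp; [exact: cf|exact: norm_continuous].
have [c _ hc] := EVT_max B0 (continuous_subspaceT cn).
exists `|f c| => x; have [xA|Ax] := lerP `|x| A; last by rewrite f0 // normr0.
by apply: hc; rewrite in_itv /= -ler_norml (le_trans xA) // le_max lexx.
Qed.

Lemma Rintegral_derive_compact (A : R) F f : vanishes_beyond A F ->
  (forall x : R, is_derive x 1 F (f x)) -> continuous f -> \int[mu]_x f x = 0.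
Proof.
move=> F0 dF cf.
have f0 := is_derive_vanishes F0 dF.
(* [B] is positive and exceeds [A]: the boundary values of [F] at B and -B vanish, and so does [f]
   outside [-B, B]. *)
pose B := Num.max A 0 + 1.
have AB : A < B by rewrite /B (@le_lt_trans _ _ (Num.max A 0)) ?le_max ?lexx // ltrDl.
have B0 : 0 < B by rewrite /B (@le_lt_trans _ _ (Num.max A 0)) ?le_max ?lexx ?orbT // ltrDl.
have cF : continuous F by move=> x; apply: is_derive_continuous (dF x).
have : (\int[mu]_(x in `[(- B)%R, B]) (f x)%:E = (F B)%:E - (F (- B))%:E)%E.
  apply: continuous_FTC2 => //.
  - by lra.
  - exact: continuous_subspaceT.
  - split.
    + by move=> x _; have [] := dF x.
    + by apply: cvg_at_right_filter; exact: cF.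
    + by apply: cvg_at_left_filter; exact: cF.
  - by move=> x _; rewrite derive1E; apply: derive_val.
rewrite !F0 ?normrN ?gtr0_norm // subee // => h.
rewrite /Rintegral [X in fine X](_ : _ = 0%E) // -{}h [RHS]integral_mkcond.
apply: eq_integral => x _; rewrite patchE; case: ifPn => // /negP xB.
rewrite f0 // ltNge; apply/negP; rewrite ler_norml => /andP[h1 h2]; apply: xB.
by rewrite inE /= in_itv /=; apply/andP; split; lra.
Qed.

Lemma Rdominated_convergence (f_ : nat -> R -> R) f g :
  (forall n, measurable_fun [set: R] (f_ n)) -> measurable_fun [set: R] f -> L1 g ->
  (forall n x, `|f_ n x| <= g x) -> (forall x, f_ n x @[n --> \oo] --> f x) ->
  \int[mu]_x f_ n x @[n --> \oo] --> \int[mu]_x f x.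
Proof.
move=> mf_ mf ig fg cf.
have fgl x : `|f x| <= g x.
  have : `|f_ n x| @[n --> \oo] --> `|f x| by apply: cvg_norm; exact: cf.
  by move=> h; apply: (cvgr_to_le h); apply: nearW => n.
have [|||||_ _] := @dominated_convergence _ _ _ mu setT measurableT
    (fun n x => (f_ n x)%:E) (EFin \o f) (EFin \o g).
- by move=> n; apply/measurable_EFinP; exact: mf_.
- by apply/measurable_EFinP.
- by apply: nearW => x _; apply/fine_cvgP; split; [exact: nearW|exact: cf].
- exact: ig.
- by apply: nearW => x n _; rewrite lee_fin.
by rewrite /= -RintE; [move=> /fine_cvgP[]|exact: L1_le ig fgl].
Qed.

(** Up to the factor 1/pi, the Poisson kernel of the half-plane at height 1. It also serves as the
    standard integrable majorant below. *)
Definition poisson_weight (x : R) := (1 + x ^+ 2)^-1.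

Lemma continuous_poisson_weight : continuous poisson_weight.
Proof. exact: continuous_oneDsqrV. Qed.

Lemma poisson_weight_gt0 x : 0 < poisson_weight x.
Proof. by rewrite invr_gt0 ltr_pwDl // sqr_ge0. Qed.

Lemma integral_poisson_weight : (\int[mu]_x (poisson_weight x)%:E = pi%:E)%E.
Proof.
rewrite ge0_symfun_integralT.
- rewrite -set_itvcy (_ : integral _ _ _ = (pi / 2)%:E)%E; last exact: integral0y_oneDsqr.
  by rewrite -EFinM mulrCA divff // mulr1.
- by move=> x; exact/ltW/poisson_weight_gt0.
- exact: continuous_poisson_weight.
- by move=> x; rewrite /poisson_weight /= sqrrN.
Qed.

Lemma L1_poisson_weight : L1 poisson_weight.
Proof.
apply/integrableP; split.
  by apply/measurable_EFinP; apply: continuous_measurable_fun; exact: continuous_poisson_weight.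
rewrite (_ : integral _ _ _ = pi%:E)%E ?ltry // -integral_poisson_weight.
by apply: eq_integral => x _ /=; rewrite ger0_norm // ltW // poisson_weight_gt0.
Qed.

End calculus.

(** * The cosine transform of the two-sided exponential *)

Section exponential_weight.
Context {R : realType}.
Local Notation mu := (@lebesgue_measure R).
Variable e : R.
Hypothesis e0 : 0 < e.

Definition exp_weight (x : R) := expR (- e * `|x|).

Lemma continuous_exp_weight : continuous exp_weight.
Proof.
move=> x; apply: continuous_comp; last exact: continuous_expR.
by apply: cvgMl_tmp; exact: norm_continuous.
Qed.

Let cvg_exp : expR (- e * x) @[x --> +oo] --> (0 : R).
Proof.
suff : e * x @[x --> +oo] --> +oo.
  move=> h; under eq_fun do rewrite mulNr.
  exact: (cvg_comp _ _ h (@cvgr_expR R)).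
apply/cvgryPge => M; near=> x.
have : x >= M / e by near: x; apply: nbhs_pinfty_ge; rewrite num_real.
by rewrite ler_pdivrMr // mulrC.
Unshelve. all: by end_near. Qed.

(* The fundamental theorem of calculus on a half-line requires a nonnegative
   integrand, hence 1 + cos instead of cos. *)
Let integral_exp_cos0y (t : R) :
  (\int[mu]_(x in `[0%R, +oo[) (expR (- e * x) * (1 + cos (t * x)))%:E =
   (e^-1 + e / (e ^+ 2 + t ^+ 2))%:E)%E.
Proof.
pose D := e ^+ 2 + t ^+ 2.
have D0 : 0 < D by rewrite ltr_wpDr ?sqr_ge0 // exprn_gt0.
(* The summand -1/e gives a primitive of exp(-e x), and the rest gives one of exp(-e x) cos(t x). *)
pose b x := - e^-1 + D^-1 * (t * sin (t * x) + - e * cos (t * x)).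
pose F x := expR (- e * x) * b x.
have dF (x : R) : is_derive x 1 F (expR (- e * x) * (1 + cos (t * x))).
  have ds := is_derive_sinM t x; have dc := is_derive_cosM t x.
  have de := is_derive_expM (- e) x.
  apply: is_derive_eq; rewrite /GRing.scale /= /b.
  have -> : e^-1 = (t ^+ 2 / e + e) * D^-1.
    by rewrite /D; field; rewrite ?gt_eqF //= /D.
  by rewrite /D; field; rewrite gt_eqF // gt_eqF.
have cF : continuous F by move=> x; apply: is_derive_continuous (dF x).
have Fy : F x @[x --> +oo] --> (0 : R).
  pose M := e^-1 + D^-1 * (`|t| + e).
  have bM x : `|b x| <= M.
    rewrite /b (le_trans (ler_normD _ _)) // lerD //.
      by rewrite normrN gtr0_norm // invr_gt0.
    rewrite normrM gtr0_norm ?invr_gt0 // ler_pM2l ?invr_gt0 //.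
    rewrite (le_trans (ler_normD _ _)) // lerD // normrM ?normrN.
      by rewrite ler_piMr // sin_max.
    by rewrite (gtr0_norm e0) ler_piMr ?cos_max // ltW.
  apply: (@squeeze_cvgr _ _ _ _ (fun x => - M * expR (- e * x)) (fun x => M * expR (- e * x))).
  - apply: nearW => x; rewrite /F mulNr -ler_norml normrM (gtr0_norm (expR_gt0 _)) mulrC.
    by rewrite ler_pM2r ?expR_gt0.
  - by rewrite -(mulr0 (- M)); apply: cvgMl_tmp.
  - by rewrite -(mulr0 M); apply: cvgMl_tmp.
rewrite (@ge0_continuous_FTC2y _ _ F 0 0).
- rewrite sub0e -EFinN /F mulr0 expR0 mul1r /b !mulr0 sin0 cos0 -/D; congr EFin.
  by ring.
- move=> x _; rewrite mulr_ge0 ?expR_ge0 //; have := cos_geN1 (t * x); lra.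
- apply: continuous_subspaceT; apply: continuousMf.
    by move=> x; apply: is_derive_continuous (is_derive_expM (- e) x).
  by apply: continuousDf; [move=> x; exact: cvg_cst|exact: continuous_cosM].
- exact: Fy.
- by move=> x _; have [] := dF x.
- by apply: cvg_at_right_filter; exact: cF.
- by move=> x _; rewrite derive1E; apply: derive_val.
Qed.

Let integral_exp_cosD1 (t : R) :
  (\int[mu]_x (exp_weight x * (1 + cos (t * x)))%:E =
   (2 * (e^-1 + e / (e ^+ 2 + t ^+ 2)))%:E)%E.
Proof.
rewrite ge0_symfun_integralT.
- rewrite -set_itvcy EFinM -integral_exp_cos0y; congr (_ * _)%E.
  apply: eq_integral => x; rewrite inE /= in_itv /= andbT => x0.
  by rewrite /exp_weight ger0_norm.
- move=> x; rewrite mulr_ge0 ?expR_ge0 //; have := cos_geN1 (t * x); lra.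
- apply: continuousMf; first exact: continuous_exp_weight.
  by apply: continuousDf; [move=> x; exact: cvg_cst|exact: continuous_cosM].
- by move=> x; rewrite /= /exp_weight normrN mulrN cosN.
Qed.

Let L1_exp_cosD1 (t : R) : L1 (fun x => exp_weight x * (1 + cos (t * x))).
Proof.
apply/integrableP; split.
  apply/measurable_EFinP; apply: continuous_measurable_fun.
  apply: continuousMf; first exact: continuous_exp_weight.
  by apply: continuousDf; [move=> x; exact: cvg_cst|exact: continuous_cosM].
rewrite (_ : integral _ _ _ = (2 * (e^-1 + e / (e ^+ 2 + t ^+ 2)))%:E) ?ltry //.
rewrite -integral_exp_cosD1.
apply: eq_integral => x _ /=; rewrite ger0_norm // mulr_ge0 ?expR_ge0 //.
Qed.

Lemma L1_exp_weight : L1 exp_weight.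
Proof.
have := L1Zl 2^-1 (L1_exp_cosD1 0); congr L1; apply/funext => x.
by rewrite mul0r cos0; field.
Qed.

Lemma L1_exp_weight_cos (t : R) : L1 (fun x => exp_weight x * cos (t * x)).
Proof.
have := L1D (L1_exp_cosD1 t) (L1Zl (-1) L1_exp_weight).
by congr L1; apply/funext => x; ring.
Qed.

(** The right-hand side is 2 pi times the Poisson kernel of height [e]. The auxiliary summand 1 is
    removed by subtracting the integral 2/e of [exp_weight], which is read off from the case t =
    0. *)
Lemma Rintegral_exp_weight_cos (t : R) :
  \int[mu]_x (exp_weight x * cos (t * x)) = 2 * e / (e ^+ 2 + t ^+ 2).
Proof.
have I1 : \int[mu]_x (exp_weight x * (1 + cos (t * x))) = 2 * (e^-1 + e / (e ^+ 2 + t ^+ 2)).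
  by rewrite /Rintegral integral_exp_cosD1.
have I0 : \int[mu]_x exp_weight x = 2 / e.
  have : \int[mu]_x (exp_weight x * (1 + cos (0 * x))) = 2 * (e^-1 + e / (e ^+ 2 + 0 ^+ 2)).
    by rewrite /Rintegral integral_exp_cosD1.
  under eq_Rintegral do rewrite mul0r cos0.
  rewrite RintegralZr //; last exact: L1_exp_weight.
  move=> h; have -> : \int[mu]_x exp_weight x = (\int[mu]_x exp_weight x * (1 + 1)) / 2 by field.
  by rewrite h; field; rewrite ?gt_eqF //= expr0n addr0 expf_neq0 // gt_eqF.
under eq_Rintegral => x _.
  rewrite (_ : _ * _ = exp_weight x * (1 + cos (t * x)) - exp_weight x); last by ring.
  over.
rewrite RintegralB //; [|exact: L1_exp_cosD1|exact: L1_exp_weight].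
by rewrite I1 I0; ring.
Qed.

End exponential_weight.

(** * Fourier inversion for even bumps *)

Section cosine_transform.
Context {R : realType}.
Local Notation mu := (@lebesgue_measure R).

(** For even [m] this is the full Fourier transform, the sine part being the integral of an odd
    function. *)
Definition cos_transform (m : R -> R) (z : R) := \int[mu]_xi (cos (z * xi) * m xi).

Variables (m m1 m2 : R -> R) (A : R).
Hypotheses (dm : forall x : R, is_derive x 1 m (m1 x))
  (dm1 : forall x : R, is_derive x 1 m1 (m2 x)) (cm2 : continuous m2)
  (m_vanishes : vanishes_beyond A m) (m_even : forall x, m (- x) = m x).

Let G := cos_transform m.

Let cm : continuous m.
Proof. by move=> x; apply: is_derive_continuous (dm x). Qed.



Let m1_vanishes : vanishes_beyond A m1 := is_derive_vanishes m_vanishes dm.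

Let m2_vanishes : vanishes_beyond A m2 := is_derive_vanishes m1_vanishes dm1.

Let L1m : L1 m := L1_compact cm m_vanishes.



Let L1cosm z : L1 (fun xi => cos (z * xi) * m xi).
Proof.
apply: (@L1_bounded_mul _ 1) => //; last by move=> x; exact: cos_max.
by apply: continuous_measurable_fun; exact: continuous_cosM.
Qed.

Let L1m2 : L1 m2 := L1_compact cm2 m2_vanishes.

Let L1cosm2 z : L1 (fun xi => cos (z * xi) * m2 xi).
Proof.
apply: (@L1_bounded_mul _ 1 _ _ _ _ L1m2); last by move=> x; exact: cos_max.
by apply: continuous_measurable_fun; exact: continuous_cosM.
Qed.

Let norm_cos_integral (f : R -> R) z : L1 f -> L1 (fun xi => cos (z * xi) * f xi) ->
  `|\int[mu]_xi (cos (z * xi) * f xi)| <= \int[mu]_xi `|f xi|.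
Proof.
move=> fi cfi; apply: le_trans (le_normr_Rintegral _ cfi) _ => //.
apply: le_Rintegral => //; [exact: L1_norm|exact: L1_norm|].
by move=> x _; rewrite normrM ler_piMl // cos_max.
Qed.

(* z^2 cos (z xi) m + cos (z xi) m'' is the derivative of
   z sin (z xi) m + cos (z xi) m'. *)
Let cos_transform_derive2 z :
  z ^+ 2 * G z = - \int[mu]_xi (cos (z * xi) * m2 xi).
Proof.
have d (x : R) : is_derive x 1 (fun x => z * sin (z * x) * m x + cos (z * x) * m1 x)
    (z ^+ 2 * (cos (z * x) * m x) + cos (z * x) * m2 x).
  have ds := is_derive_sinM z x; have dc := is_derive_cosM z x.
  have := dm x; have := dm1 x => dm1x dmx.
  by apply: is_derive_eq; rewrite /GRing.scale /=; ring.
have : \int[mu]_x (z ^+ 2 * (cos (z * x) * m x) + cos (z * x) * m2 x) = 0.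
  apply: (@Rintegral_derive_compact _ A _ _ _ d).
    by apply: vanishesD; exact: vanishesM.
  apply: continuousDf; apply: continuousMf; [by move=> x; exact: cvg_cst| |exact: continuous_cosM|exact: cm2].
  by apply: continuousMf; [exact: continuous_cosM|].
rewrite RintegralD //; [|exact: (L1Zl (z ^+ 2) (L1cosm z))|exact: L1cosm2].
by rewrite RintegralZl //; [move=> h; rewrite /G /cos_transform; lra|exact: L1cosm].
Qed.

(** The integrals of |m| and |m''| bound |G| and |z^2 G| respectively; adding the two bounds
    controls (1 + z^2) |G|. *)
Lemma cos_transform_decay :
  exists2 C : R, 0 <= C & forall z, `|G z| <= C * poisson_weight z.
Proof.
exists (\int[mu]_xi `|m xi| + \int[mu]_xi `|m2 xi|).
  by rewrite addr_ge0 // Rintegral_ge0.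
move=> z; rewrite ler_pdivlMr ?ltr_pwDl ?sqr_ge0 // mulrDr mulr1 lerD //.
  exact: norm_cos_integral.
rewrite -(ger0_norm (sqr_ge0 z)) -normrM mulrC cos_transform_derive2 normrN.
exact: norm_cos_integral.
Qed.

Lemma continuous_cos_transform : continuous G.
Proof.
move=> a.
have := @continuity_under_integral R _ _ mu (fun z xi => cos (z * xi) * m xi) setT
  measurableT (a - 1) (a + 1) _ _ (fun xi => `|m xi|) _ _ a.
apply.
- by move=> z _; exact: L1cosm.
- apply: nearW => xi _ z _; apply: cvgM; last exact: cvg_cst.
  by under eq_fun do rewrite mulrC; rewrite mulrC; exact: continuous_cosM.
- exact: L1_norm.
- by move=> z _; apply: nearW => xi _; rewrite normrM ler_piMl // cos_max.
- by rewrite inE /= in_itv /=; apply/andP; split; lra.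
Qed.

Lemma L1_cos_transform : L1 G.
Proof.
have [C _ CG] := cos_transform_decay.
apply: (L1_le _ (L1Zl C L1_poisson_weight)) => //.
by apply: continuous_measurable_fun; exact: continuous_cos_transform.
Qed.

Lemma cos_transform_even z : G (- z) = G z.
Proof. by rewrite /G /cos_transform; under eq_Rintegral do rewrite mulNr cosN. Qed.

Let continuous_cauchy (e l : R) : 0 < e ->
  continuous (fun xi => e / (e ^+ 2 + (xi - l) ^+ 2)).
Proof.
move=> e0 x; apply: cvgM; first exact: cvg_cst.
apply: cvgV; first by rewrite gt_eqF // ltr_wpDr ?sqr_ge0 // exprn_gt0.
apply: cvgD; first exact: cvg_cst.
under eq_fun do rewrite expr2.
by rewrite expr2; apply: cvgM; apply: cvgB; by [exact: cvg_id|exact: cvg_cst].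
Qed.

(** The substitution xi = l + e t turns the Poisson kernel of height [e] centred at [l] into a
    weight independent of [e]. *)
Let poisson_average (e l : R) : 0 < e ->
  \int[mu]_xi (m xi * (e / (e ^+ 2 + (xi - l) ^+ 2))) =
  \int[mu]_t (m (l + e * t) * poisson_weight t).
Proof.
move=> e0.
have h (x : R) : 0 < e ^+ 2 + x ^+ 2 by rewrite ltr_wpDr ?sqr_ge0 // exprn_gt0.
rewrite -[LHS](@Rintegral_affine _ _ l e) //.
- apply: eq_Rintegral => t _; rewrite -!mulrA; congr (_ * _).
  have ht : 0 < 1 + t ^+ 2 by rewrite ltr_pwDl // sqr_ge0.
  have := h (e * t); rewrite /poisson_weight addrAC subrr add0r => h'.
  by field; rewrite ?gt_eqF.
- by apply: continuousMf => //; exact: continuous_cauchy.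
Qed.

Let eps (n : nat) : R := n.+1%:R^-1.

Let eps_gt0 n : 0 < eps n. Proof. by rewrite invr_gt0. Qed.

Let cvg_eps : eps n @[n --> \oo] --> 0.
Proof. exact: cvg_harmonic. Qed.



(** The Poisson kernels form an approximate identity: [m] is continuous at [l] and bounded by some
    B, so B times the weight dominates, and the total mass of the weight is pi. *)
Let cvg_poisson_average (l : R) :
  \int[mu]_t (m (l + eps n * t) * poisson_weight t) @[n --> \oo] --> m l * pi.
Proof.
have [B mB] := vanishes_bounded cm m_vanishes.
have -> : m l * pi = \int[mu]_t (m l * poisson_weight t).
  rewrite RintegralZl //; last exact: L1_poisson_weight.
  by rewrite /Rintegral integral_poisson_weight.
have mw : measurable_fun [set: R] poisson_weight.
  by apply: continuous_measurable_fun; exact: continuous_poisson_weight.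
apply: (@Rdominated_convergence _ _ _ (fun t => B * poisson_weight t)).
- move=> n; apply: measurable_funM => //; apply: continuous_measurable_fun.
  exact: continuous_affine.
- by apply: measurable_funM.
- exact: L1Zl L1_poisson_weight.
- move=> n x; rewrite normrM (gtr0_norm (poisson_weight_gt0 x)) ler_pM2r //.
  exact: poisson_weight_gt0.
- move=> x; apply: cvgM; last exact: cvg_cst.
  suff h : l + eps n * x @[n --> \oo] --> l by exact: (cvg_comp _ _ h (@cm l)).
  rewrite -[X in _ --> X]addr0; apply: cvgD; first exact: cvg_cst.
  by rewrite -(mul0r x); apply: cvgM; [exact: cvg_eps|exact: cvg_cst].
Qed.

Let L1m_poisson (e l : R) : 0 < e -> L1 (fun xi => m xi * (e / (e ^+ 2 + (xi - l) ^+ 2))).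
Proof.
move=> e0.
apply: (@L1_compact _ _ A).
  by apply: continuousMf => //; exact: continuous_cauchy.
by move=> x Ax; rewrite m_vanishes // mul0r.
Qed.

(** The exponential factor makes the double integral absolutely convergent. After Fubini, cos(l z)
    cos(z xi) splits into cosines of (xi - l) z and (xi + l) z, whose weighted integrals are Poisson
    kernels centred at l and -l. *)
Let regularized_inversion (e l : R) : 0 < e ->
  \int[mu]_z (exp_weight e z * cos (l * z) * G z) =
  \int[mu]_t (m (l + e * t) * poisson_weight t) +
  \int[mu]_t (m (- l + e * t) * poisson_weight t).
Proof.
move=> e0.
rewrite -!poisson_average // -RintegralD //; try exact: L1m_poisson.
have mw : measurable_fun [set: R] (exp_weight e).
  by apply: continuous_measurable_fun; exact: continuous_exp_weight.
have mc : measurable_fun [set: R] (@cos R).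
  by apply: continuous_measurable_fun; exact: continuous_cos.
have mm : measurable_fun [set: R] m by exact: continuous_measurable_fun.
pose f z xi := exp_weight e z * cos (l * z) * (cos (z * xi) * m xi).
transitivity (\int[mu]_z \int[mu]_xi f z xi).
  by apply: eq_Rintegral => z _; rewrite -RintegralZl //; exact: L1cosm.
rewrite (@dominated_Fubini _ f (exp_weight e) (fun xi => `|m xi|)).
- apply: eq_Rintegral => xi _; rewrite /f.
  under eq_Rintegral => z _.
    rewrite (_ : _ * _ = m xi / 2 * (exp_weight e z * cos ((xi - l) * z) +
      exp_weight e z * cos ((xi - - l) * z))); last first.
      by rewrite opprK !mulrDl mulNr cosB cosD (mulrC z); field.
    over.
  rewrite RintegralZl //; last by apply: L1D; exact: L1_exp_weight_cos.
  rewrite RintegralD //; try exact: L1_exp_weight_cos.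
  rewrite !Rintegral_exp_weight_cos //.
  set a := (e ^+ 2 + (xi - l) ^+ 2)^-1; set b := (e ^+ 2 + (xi - - l) ^+ 2)^-1.
  by field.
- apply: measurable_funM; first apply: measurable_funM.
  + exact: measurableT_comp mw measurable_fst.
  + by apply: measurableT_comp => //; apply: measurable_funM => //; exact: measurable_fst.
  + apply: measurable_funM; last exact: measurableT_comp mm measurable_snd.
    apply: measurableT_comp => //; apply: measurable_funM; [exact: measurable_fst|exact: measurable_snd].
- exact: L1_exp_weight.
- exact: L1_norm.
- move=> z xi; rewrite /f !normrM (ger0_norm (expR_ge0 _)) -mulrA ler_wpM2l ?expR_ge0 //.
  by rewrite mulrA ler_piMl // mulr_ile1 // cos_max.
Qed.

(** Let e tend to 0 in [regularized_inversion]. The left side converges by domination with the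
    integrable |G|; on the right the two averages tend to pi m(l) and pi m(-l), which agree by
    evenness. *)
Lemma cos_transform_inversion l :
  \int[mu]_z (cos (l * z) * G z) = 2 * pi * m l.
Proof.
have mG : measurable_fun [set: R] G.
  by apply: continuous_measurable_fun; exact: continuous_cos_transform.
have mc : measurable_fun [set: R] (fun z => cos (l * z)).
  by apply: continuous_measurable_fun; exact: continuous_cosM.
have h1 : \int[mu]_z (exp_weight (eps n) z * cos (l * z) * G z) @[n --> \oo] -->
    \int[mu]_z (cos (l * z) * G z).
  apply: (@Rdominated_convergence _ _ _ (fun z => `|G z|)).
  - move=> n; apply: measurable_funM => //; apply: measurable_funM => //.
    by apply: continuous_measurable_fun; exact: continuous_exp_weight.
  - exact: measurable_funM.
  - exact: L1_norm L1_cos_transform.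
  - move=> n z; rewrite !normrM ler_piMl // mulr_ile1 ?cos_max //.
    rewrite ger0_norm ?expR_ge0 // -expR0 ler_expR mulNr oppr_le0.
    by rewrite mulr_ge0 // ltW.
  - move=> z; under eq_fun do rewrite -mulrA.
    suff h : exp_weight (eps n) z @[n --> \oo] --> (1 : R).
      have /(_ _ _ _ (cvg_cst (cos (l * z) * G z))) := cvgM h.
      by rewrite mul1r; apply.
    rewrite -(@expR0 R).
    suff h : - eps n * `|z| @[n --> \oo] --> (0 : R).
      exact: (cvg_comp _ _ h (@continuous_expR R 0)).
    rewrite -(mul0r `|z|) -oppr0; apply: cvgM; last exact: cvg_cst.
    by apply: cvgN; exact: cvg_eps.
have h2 : \int[mu]_z (exp_weight (eps n) z * cos (l * z) * G z) @[n --> \oo] -->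
    m l * pi + m (- l) * pi.
  under eq_fun do rewrite regularized_inversion //.
  by apply: cvgD; exact: cvg_poisson_average.
have := cvg_unique _ h1 h2 => ->; last exact: norm_hausdorff.
by rewrite m_even; ring.
Qed.

Lemma sin_cos_transform l : \int[mu]_z (sin (l * z) * G z) = 0.
Proof.
apply: Rintegral_odd.
  by apply: continuousMf; [exact: continuous_sinM|exact: continuous_cos_transform].
by move=> z; rewrite mulrN sinN cos_transform_even mulNr.
Qed.

Lemma sin_transform_eq0 z : \int[mu]_xi (sin (z * xi) * m xi) = 0.
Proof.
apply: Rintegral_odd; first by apply: continuousMf; [exact: continuous_sinM|].
by move=> xi; rewrite mulrN sinN m_even mulNr.
Qed.

End cosine_transform.

(** * Complex-valued functions *)

Section complex_integrals.
Context {R : realType}.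
Local Notation mu := (@lebesgue_measure R).
Local Notation normc := (@Normc.normc R).
Implicit Types F G psi : R -> R[i].

Lemma le_Re_normc (z : R[i]) : `|complex.Re z| <= normc z.
Proof. by have := normc_ge_Re z; rewrite normc_def lecR; case: z. Qed.

Lemma le_Im_normc (z : R[i]) : `|complex.Im z| <= normc z.
Proof.
have := le_Re_normc (z * 'i); rewrite ReiNIm normrN Normc.normcM => /le_trans; apply.
by rewrite [X in _ * X](_ : _ = 1) ?mulr1 // /= expr0n expr1n add0r sqrtr1.
Qed.

Lemma normc_ge0 (z : R[i]) : 0 <= normc z.
Proof. exact: le_trans (normr_ge0 _) (le_Re_normc z). Qed.

Lemma normc_le_ReIm (z : R[i]) : normc z <= `|complex.Re z| + `|complex.Im z|.
Proof.
case: z => x y /=; rewrite -[leRHS]ger0_norm ?addr_ge0 // -sqrtr_sqr ler_wsqrtr //.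
by rewrite sqrrD !real_normK ?num_real // addrAC lerDl mulrn_wge0 // mulr_ge0.
Qed.

Lemma normc_real (x : R) : normc x%:C = `|x|.
Proof. by rewrite /= expr0n addr0 sqrtr_sqr. Qed.

Lemma cReD (x y : R[i]) : complex.Re (x + y) = complex.Re x + complex.Re y.
Proof. by case: x; case: y. Qed.

Lemma cImD (x y : R[i]) : complex.Im (x + y) = complex.Im x + complex.Im y.
Proof. by case: x; case: y. Qed.

Lemma cReM (x y : R[i]) : complex.Re (x * y) =
  complex.Re x * complex.Re y - complex.Im x * complex.Im y.
Proof. by case: x; case: y. Qed.

Lemma cImM (x y : R[i]) : complex.Im (x * y) =
  complex.Re x * complex.Im y + complex.Im x * complex.Re y.
Proof. by case: x; case: y. Qed.

Lemma eq_cintegral F G : F =1 G -> cintegral F = cintegral G.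
Proof. by move=> FG; congr cintegral; apply/funext. Qed.

Definition cmeasurable d (T : measurableType d) (F : T -> R[i]) :=
  measurable_fun setT (fun x => complex.Re (F x)) /\
  measurable_fun setT (fun x => complex.Im (F x)).

Lemma cmeasurableD d (T : measurableType d) (F G : T -> R[i]) :
  cmeasurable F -> cmeasurable G -> cmeasurable (fun x => F x + G x).
Proof.
move=> [F1 F2] [G1 G2]; split.
  by under eq_fun do rewrite cReD; exact: measurable_funD.
by under eq_fun do rewrite cImD; exact: measurable_funD.
Qed.

Lemma cmeasurableM d (T : measurableType d) (F G : T -> R[i]) :
  cmeasurable F -> cmeasurable G -> cmeasurable (fun x => F x * G x).
Proof.
move=> [F1 F2] [G1 G2]; split.
  by under eq_fun do rewrite cReM; apply: measurable_funB; exact: measurable_funM.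
by under eq_fun do rewrite cImM; apply: measurable_funD; exact: measurable_funM.
Qed.

Lemma cmeasurable_cst d (T : measurableType d) (c : R[i]) : cmeasurable (fun _ : T => c).
Proof. by split; exact: measurable_cst. Qed.

Lemma cmeasurable_real d (T : measurableType d) (f : T -> R) :
  measurable_fun setT f -> cmeasurable (fun x => (f x)%:C).
Proof. by move=> mf; split => //=; exact: measurable_cst. Qed.

Lemma cmeasurable_comp d (T : measurableType d) F (g : T -> R) :
  cmeasurable F -> measurable_fun setT g -> cmeasurable (F \o g).
Proof.
by move=> [F1 F2] mg; split; [exact: (measurableT_comp F1 mg)|exact: (measurableT_comp F2 mg)].
Qed.

Definition cL1 F := L1 (fun x => complex.Re (F x)) /\ L1 (fun x => complex.Im (F x)).

Lemma cL1_le F (g : R -> R) : cmeasurable F -> L1 g ->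
  (forall x, normc (F x) <= g x) -> cL1 F.
Proof.
move=> [F1 F2] gi Fg; split; apply: (L1_le _ gi) => // x.
  exact: le_trans (le_Re_normc _) (Fg x).
exact: le_trans (le_Im_normc _) (Fg x).
Qed.

Lemma cintegralD F G : cL1 F -> cL1 G ->
  cintegral (fun x => F x + G x) = cintegral F + cintegral G.
Proof.
move=> [F1 F2] [G1 G2]; rewrite /cintegral.
under eq_Rintegral do rewrite cReD.
under [X in _ +i* X]eq_Rintegral do rewrite cImD.
by rewrite !RintegralD.
Qed.

Lemma L1N (f : R -> R) : L1 f -> L1 (fun x => - f x).
Proof. by move/(L1Zl (-1)); congr L1; apply/funext => x; rewrite mulN1r. Qed.

Lemma cintegralZ (a : R[i]) F : cL1 F ->
  cintegral (fun x => a * F x) = a * cintegral F.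
Proof.
move=> [F1 F2]; rewrite /cintegral.
under eq_Rintegral do rewrite cReM.
under [X in _ +i* X]eq_Rintegral do rewrite cImM.
rewrite RintegralB //; [|exact: (L1Zl _ F1)|exact: (L1Zl _ F2)].
rewrite RintegralD //; [|exact: (L1Zl _ F2)|exact: (L1Zl _ F1)].
by rewrite !RintegralZl //; case: a.
Qed.

Lemma cL1Z (a : R[i]) F : cL1 F -> cL1 (fun x => a * F x).
Proof.
move=> [F1 F2]; split.
  under eq_fun do rewrite cReM.
  exact: (L1D (L1Zl _ F1) (L1N (L1Zl _ F2))).
under eq_fun do rewrite cImM.
exact: (L1D (L1Zl _ F2) (L1Zl _ F1)).
Qed.



Lemma cintegral_Fubini (f : R -> R -> R[i]) (a b : R -> R) :
  cmeasurable (fun p : R * R => f p.1 p.2) -> L1 a -> L1 b ->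
  (forall x y, normc (f x y) <= a x * b y) ->
  cintegral (fun x => cintegral (f x)) = cintegral (fun y => cintegral (f ^~ y)).
Proof.
move=> [f1 f2] ia ib fab; rewrite /cintegral /=; congr (_ +i* _).
  apply: (dominated_Fubini (f := fun x y => complex.Re (f x y)) f1 ia ib) => x y.
  exact: le_trans (le_Re_normc _) (fab x y).
apply: (dominated_Fubini (f := fun x y => complex.Im (f x y)) f2 ia ib) => x y.
exact: le_trans (le_Im_normc _) (fab x y).
Qed.

Definition cexp (l x : R) : R[i] := cos (l * x) +i* sin (l * x).

Lemma cexpM (k l x : R) : cexp k x * cexp l x = cexp (k + l) x.
Proof.
rewrite /cexp mulrDl cosD sinD; simpc; congr (_ +i* _).
by rewrite addrC mulrC.
Qed.

Lemma normc_cexp (l x : R) : normc (cexp l x) = 1.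
Proof. by rewrite /cexp /= cos2Dsin2 sqrtr1. Qed.

Lemma cmeasurable_cexp (l : R) : cmeasurable (cexp l).
Proof.
by split; apply: continuous_measurable_fun; [exact: continuous_cosM|exact: continuous_sinM].
Qed.

Lemma schwartz_measurable psi : schwartz psi -> cmeasurable psi.
Proof.
by move=> [s1 s2 _]; split; apply: continuous_measurable_fun => x;
  apply/differentiable_continuous/derivable1_diffP; [exact: (s1 0%N x)|exact: (s2 0%N x)].
Qed.

(** Combine the seminorms of order 0 and 4 through (1 + x^2)^2 <= 2 (1 + x^4). The weight is squared
    because one factor will be spent in Peetre's inequality and the other must remain for
    integrability. *)
Lemma schwartz_decay psi : schwartz psi -> exists2 M, 0 <= M &
  forall x, normc (psi x) <= M * poisson_weight x ^+ 2.
Proof.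
move=> [_ _ sb].
have cd0 x : cderiv 0 psi x = psi x by rewrite /cderiv /=; case: (psi x).
have [M0 h0] := sb 0%N 0%N; have [M4 h4] := sb 4%N 0%N.
exists (2 * (`|M0| + `|M4|)); first by rewrite mulr_ge0 // addr_ge0.
move=> x; rewrite /poisson_weight exprVn ler_pdivlMr ?exprn_gt0 ?ltr_pwDl ?sqr_ge0 //.
have := h0 x; have := h4 x; rewrite cd0 expr0 mul1r => H4 H0.
have e4 : `|x| ^+ 4 = x ^+ 4 by rewrite -normrX ger0_norm // (exprM x 2 2) sqr_ge0.
have p : (1 + x ^+ 2) ^+ 2 <= 2 * (1 + x ^+ 4).
  rewrite -subr_ge0 (_ : _ - _ = (1 - x ^+ 2) ^+ 2); last by ring.
  exact: sqr_ge0.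
apply: (@le_trans _ _ (normc (psi x) * (2 * (1 + x ^+ 4)))).
  by rewrite ler_wpM2l // normc_ge0.
rewrite mulrCA ler_pM2l // mulrDr mulr1 lerD //.
  exact: le_trans H0 (ler_norm _).
by rewrite mulrC -e4; exact: le_trans H4 (ler_norm _).
Qed.

Lemma poisson_weight_le1 (x : R) : poisson_weight x <= 1.
Proof. by rewrite invf_le1 ?ltr_pwDl ?sqr_ge0 // lerDl sqr_ge0. Qed.

(* Peetre's inequality. *)
Lemma poisson_weight_shift (x y : R) :
  poisson_weight (x - y) * poisson_weight y <= 2 * poisson_weight x.
Proof.
rewrite /poisson_weight -invfM.
have px : 0 < 1 + x ^+ 2 by rewrite ltr_pwDl ?sqr_ge0.
have py : 0 < 1 + y ^+ 2 by rewrite ltr_pwDl ?sqr_ge0.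
have pxy : 0 < 1 + (x - y) ^+ 2 by rewrite ltr_pwDl ?sqr_ge0.
rewrite ler_pdivlMr // mulrC ler_pdivrMr ?mulr_gt0 //.
rewrite -subr_ge0.
rewrite (_ : _ - _ = 1 + (2 * y - x) ^+ 2 + 2 * ((x - y) * y) ^+ 2); last by ring.
by rewrite !addr_ge0 // ?sqr_ge0 // mulr_ge0 // sqr_ge0.
Qed.

Lemma schwartz_normc_L1 psi : schwartz psi -> exists2 b, L1 b & forall x, normc (psi x) <= b x.
Proof.
move=> sp; have [M M0 h] := schwartz_decay sp.
exists (fun x => M * poisson_weight x); first exact: L1Zl L1_poisson_weight.
move=> x; apply: le_trans (h x) _; rewrite ler_wpM2l // expr2 ler_piMr ?poisson_weight_le1 //.
exact/ltW/poisson_weight_gt0.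
Qed.

(** The bound holds at every point, so no exceptional null set has to be carried along. *)
Definition bounded_measurable F := cmeasurable F /\ exists B, forall x, normc (F x) <= B.

Lemma cL1_bounded_mul F G (b : R -> R) : bounded_measurable F -> cmeasurable G -> L1 b ->
  (forall x, normc (G x) <= b x) -> cL1 (fun x => F x * G x).
Proof.
move=> [mF [B FB]] mG ib Gb; apply: (@cL1_le _ (fun x => B * b x)).
- exact: cmeasurableM.
- exact: L1Zl.
- by move=> x; rewrite Normc.normcM ler_pM ?normc_ge0.
Qed.

Lemma cL1_schwartz F psi : bounded_measurable F -> schwartz psi -> cL1 (fun x => F x * psi x).
Proof.
move=> bF sp; have [b ib pb] := schwartz_normc_L1 sp.
exact: (cL1_bounded_mul bF (schwartz_measurable sp) ib pb).
Qed.

Lemma bounded_measurable_cexp l : bounded_measurable (cexp l).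
Proof. by split; [exact: cmeasurable_cexp|exists 1 => x; rewrite normc_cexp]. Qed.

Lemma bounded_measurable_lin (a : R[i]) F G : bounded_measurable F -> bounded_measurable G ->
  bounded_measurable (fun x => a * F x + G x).
Proof.
move=> [mF [B FB]] [mG [C GC]]; split.
  by apply: cmeasurableD => //; apply: cmeasurableM => //; exact: cmeasurable_cst.
exists (normc a * B + C) => x; apply: le_trans (le_normcD _ _) _.
by rewrite lerD // Normc.normcM ler_wpM2l // normc_ge0.
Qed.

End complex_integrals.

(** * Fourier multipliers as convolutions *)

Section multiplier_convolution.
Context {R : realType}.
Local Notation mu := (@lebesgue_measure R).
Local Notation normc := (@Normc.normc R).
Implicit Types (F G psi : R -> R[i]) (m : R -> R).

(** Two derivatives and compact support give the kernel its decay of order 1/(1 + z^2); evenness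
    makes the kernel a real cosine transform. *)
Definition even_bump m := exists A m1 m2,
  [/\ forall x : R, is_derive x 1 m (m1 x), forall x : R, is_derive x 1 m1 (m2 x),
      continuous m2, vanishes_beyond A m & forall x, m (- x) = m x].

Definition lp_kernel m (z : R) : R := (2 * pi)^-1 * cos_transform m z.

(** The kernel is even, so the argument [x - y] gives the usual convolution. *)
Definition lp_conv m F (y : R) : R[i] :=
  cintegral (fun x => F x * (lp_kernel m (x - y))%:C).



Section fixed_multiplier.
Variable m : R -> R.
Hypothesis bm : even_bump m.
Local Notation K := (lp_kernel m).

Let continuous_lp_kernel : continuous K.
Proof.
have [A [m1 [m2 [d1 d2 c2 v e]]]] := bm.
apply: continuousMf; first by move=> x; exact: cvg_cst.
by move=> x; exact: (continuous_cos_transform d1 v).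
Qed.

Let measurable_lp_kernel : measurable_fun [set: R] K.
Proof. exact: continuous_measurable_fun. Qed.

Let lp_kernel_decay : exists2 C, 0 <= C & forall z, `|K z| <= C * poisson_weight z.
Proof.
have [A [m1 [m2 [d1 d2 c2 v e]]]] := bm.
have [C C0 h] := cos_transform_decay d1 d2 c2 v.
exists (`|(2 * pi)^-1| * C) => [|z]; first by rewrite mulr_ge0.
by rewrite normrM -mulrA ler_wpM2l.
Qed.

Let cmeasurable_kernel_shift (y : R) : cmeasurable (fun x : R => (K (x - y))%:C).
Proof.
apply: cmeasurable_real; apply: (measurableT_comp measurable_lp_kernel).
exact: measurable_funB.
Qed.

(** Peetre's inequality bounds the shifted weight by 2 (1 + y^2) times the unshifted one. *)
Let L1_poisson_shift (y : R) : L1 (fun x : R => poisson_weight (x - y)).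
Proof.
apply: (L1_le _ (L1Zl (2 * (1 + y ^+ 2)) L1_poisson_weight)) => [|x].
  apply: continuous_measurable_fun => x.
  apply: (@continuous_comp _ _ _ (fun x => x - y) poisson_weight).
    by apply: cvgB; [exact: cvg_id|exact: cvg_cst].
  exact: continuous_poisson_weight.
rewrite ger0_norm ?(ltW (poisson_weight_gt0 _)) //.
rewrite mulrAC -ler_pdivrMr ?ltr_pwDl ?sqr_ge0 //.
exact: poisson_weight_shift.
Qed.

Let cL1_conv F y : bounded_measurable F -> cL1 (fun x => F x * (K (x - y))%:C).
Proof.
move=> bF; have [C C0 h] := lp_kernel_decay.
apply: (cL1_bounded_mul bF (cmeasurable_kernel_shift y) (L1Zl C (L1_poisson_shift y))) => x.
by rewrite normc_real.
Qed.

Lemma lp_conv_lin (a : R[i]) F G : bounded_measurable F -> bounded_measurable G ->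
  lp_conv m (fun x => a * F x + G x) = fun y => a * lp_conv m F y + lp_conv m G y.
Proof.
move=> bF bG; apply/funext => y; rewrite /lp_conv -cintegralZ; last exact: cL1_conv.
rewrite -cintegralD; [|by apply: cL1Z; exact: cL1_conv|exact: cL1_conv].
by apply: eq_cintegral => x; rewrite mulrDl mulrA.
Qed.

(** Shift x = y + z and expand the cosine and sine of l (y + z). The cosine integrals against the
    kernel equal m(l) by Fourier inversion, and the sine integrals vanish by oddness. *)
Lemma lp_conv_cexp l y : lp_conv m (cexp l) y = (m l)%:C * cexp l y.
Proof.
have [A [m1 [m2 [d1 d2 c2 v e]]]] := bm.
have cG : continuous (cos_transform m) by move=> x; exact: (continuous_cos_transform d1 v).
have L1G := L1_cos_transform d1 d2 c2 v.
have L1c : L1 (fun z => cos (l * z) * cos_transform m z).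
  apply: (@L1_bounded_mul _ 1) => //; last by move=> x; exact: cos_max.
  by apply: continuous_measurable_fun; exact: continuous_cosM.
have L1s : L1 (fun z => sin (l * z) * cos_transform m z).
  apply: (@L1_bounded_mul _ 1) => //; last by move=> x; exact: sin_max.
  by apply: continuous_measurable_fun; exact: continuous_sinM.
have shift_int (g : R -> R) : continuous g ->
    \int[mu]_x (g x * K (x - y)) = \int[mu]_z (g (y + z) * K z).
  move=> cg; rewrite -(@Rintegral_shift _ (fun x => g x * K (x - y)) y).
    by apply: eq_Rintegral => z _; rewrite addrAC subrr add0r.
  apply: continuousMf => // x; apply: (@continuous_comp _ _ _ (fun x => x - y) K).
    by apply: cvgB; [exact: cvg_id|exact: cvg_cst].
  exact: continuous_lp_kernel.
rewrite /lp_conv /cintegral.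
under eq_Rintegral do rewrite cReM mulr0 subr0.
under [X in _ +i* X]eq_Rintegral do rewrite cImM mulr0 add0r.
rewrite [X in X +i* _](shift_int (fun x => cos (l * x))); last exact: continuous_cosM.
rewrite [X in _ +i* X](shift_int (fun x => sin (l * x))); last exact: continuous_sinM.
under eq_Rintegral => z _.
  rewrite (_ : _ * _ = (2 * pi)^-1 * cos (l * y) * (cos (l * z) * cos_transform m z)
    + - ((2 * pi)^-1 * sin (l * y)) * (sin (l * z) * cos_transform m z)); last first.
    by rewrite mulrDr cosD /lp_kernel; ring.
  over.
under [X in _ +i* X]eq_Rintegral => z _.
  rewrite (_ : _ * _ = (2 * pi)^-1 * sin (l * y) * (cos (l * z) * cos_transform m z)
    + (2 * pi)^-1 * cos (l * y) * (sin (l * z) * cos_transform m z)); last first.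
    by rewrite mulrDr sinD /lp_kernel; ring.
  over.
rewrite !RintegralD //; try exact: (L1Zl _ L1c); try exact: (L1Zl _ L1s).
rewrite !RintegralZl // (cos_transform_inversion d1 d2 c2 v e) (sin_cos_transform d1 v).
rewrite !mulr0 !addr0 /cexp; simpc.
have := lt0r_neq0 (pi_gt0 R); move: (@pi R) => p p0.
by congr (_ +i* _); field.
Qed.

(** Compact support of [m] and decay of [psi] allow Fubini. The inner integral of exp(i (y - x) xi)
    m(xi) is then the cosine transform at y - x, its sine part being 0 by evenness of [m]. *)
Let fourier_multiplier psi x : schwartz psi ->
  fourier (fun xi => (m xi)%:C * inv_fourier psi xi) x =
  cintegral (fun y => (K (x - y))%:C * psi y).
Proof.
move=> sp; have [A [m1 [m2 [d1 d2 c2 v e]]]] := bm.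
have cm : continuous m by move=> z; exact: is_derive_continuous (d1 z).
have mm : measurable_fun [set: R] m by exact: continuous_measurable_fun.
have L1m : L1 m := L1_compact cm v.
have mp := schwartz_measurable sp; have [b ib pb] := schwartz_normc_L1 sp.
have L1p xi : cL1 (fun y => cexp xi y * psi y).
  exact: cL1_schwartz (bounded_measurable_cexp xi) sp.
pose k : R[i] := ((2 * pi)^-1)%:C.
pose f xi y := cexp (- xi) x * ((m xi)%:C * (k * (cexp xi y * psi y))).
rewrite /fourier (@eq_cintegral _ _ (fun xi => cintegral (f xi))); last first.
  move=> xi; rewrite /f !cintegralZ; [|by do ?apply: cL1Z..].
  by rewrite /inv_fourier /cexp mulNr cosN sinN (mulrC xi).
have bounds xi y : normc (f xi y) <= (`|(2 * pi)^-1| * `|m xi|) * b y.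
  rewrite /f !Normc.normcM !normc_cexp !normc_real !mul1r mulrCA -mulrA.
  by rewrite ler_wpM2l // ler_wpM2l.
rewrite (cintegral_Fubini _ (L1Zl _ (L1_norm L1m)) ib bounds); last first.
  apply: cmeasurableM.
    split; apply: measurableT_comp => //=.
    + by apply: continuous_measurable_fun; exact: continuous_cos.
    + by apply: measurable_funM => //; apply: measurableT_comp => //; exact: measurable_fst.
    + by apply: continuous_measurable_fun; exact: continuous_sin.
    + by apply: measurable_funM => //; apply: measurableT_comp => //; exact: measurable_fst.
  apply: cmeasurableM.
    by apply: cmeasurable_real; exact: (measurableT_comp mm measurable_fst).
  apply: cmeasurableM; first exact: cmeasurable_cst.
  apply: cmeasurableM; last exact: (cmeasurable_comp mp measurable_snd).
  have mxy : measurable_fun [set: R * R] (fun p : R * R => p.1 * p.2).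
    by apply: measurable_funM; [exact: measurable_fst|exact: measurable_snd].
  split; apply: (measurableT_comp _ mxy); apply: continuous_measurable_fun.
    exact: continuous_cos.
  exact: continuous_sin.
apply: eq_cintegral => y.
rewrite (@eq_cintegral _ _ (fun xi => (k * psi y) * (cexp (y - x) xi * (m xi)%:C))); last first.
  move=> xi; rewrite /f.
  have -> : cexp (y - x) xi = cexp (- xi) x * cexp xi y.
    rewrite addrC -cexpM; congr (_ * _); first by rewrite /cexp !mulNr mulrC.
    by rewrite /cexp mulrC.
  by ring.
rewrite cintegralZ; last first.
  apply: (@cL1_le _ _ (fun xi => `|m xi|)); last first.
  - by move=> xi; rewrite Normc.normcM normc_cexp normc_real mul1r.
  - exact: L1_norm.
  - by apply: cmeasurableM; [exact: cmeasurable_cexp|exact: cmeasurable_real].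
rewrite mulrAC; congr (_ * _).
rewrite /cintegral.
under eq_Rintegral do rewrite cReM mulr0 subr0.
under [X in _ +i* X]eq_Rintegral do rewrite cImM mulr0 add0r.
rewrite /= (sin_transform_eq0 d1 e) -/(cos_transform m (y - x)).
by rewrite -opprB cos_transform_even /k /lp_kernel -rmorphM.
Qed.

(** The convolution moves from [psi] to [F] by a second use of Fubini. Peetre's inequality provides
    the majorant: it bounds |K(x - y) psi(y)|, which involves w(x - y) w(y)^2, by a multiple of w(x)
    w(y), where w is the Poisson weight. *)
Lemma multiplier_distr_of F psi : bounded_measurable F -> schwartz psi ->
  multiplier m (distr_of F) psi = distr_of (lp_conv m F) psi.
Proof.
move=> bF sp; have [mF [B FB]] := bF.
have B0 : 0 <= B by apply: le_trans (FB 0); exact: normc_ge0.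
have mp := schwartz_measurable sp; have [M M0 pM] := schwartz_decay sp.
have [C C0 KC] := lp_kernel_decay.
rewrite /multiplier /distr_inv_fourier /distr_mul /distr_fourier /distr_of.
pose f x y := F x * ((K (x - y))%:C * psi y).
have mf : cmeasurable (fun p : R * R => f p.1 p.2).
  apply: cmeasurableM; first exact: (cmeasurable_comp mF measurable_fst).
  apply: cmeasurableM; last exact: (cmeasurable_comp mp measurable_snd).
  apply: cmeasurable_real; apply: (measurableT_comp measurable_lp_kernel).
  by apply: measurable_funB; [exact: measurable_fst|exact: measurable_snd].
pose a (x : R) := B * C * M * 2 * poisson_weight x.
have kernel_bound x y : normc ((K (x - y))%:C * psi y) <=
    (C * M * 2 * poisson_weight x) * poisson_weight y.
  rewrite Normc.normcM normc_real.
  apply: (@le_trans _ _ (C * poisson_weight (x - y) * (M * poisson_weight y ^+ 2))).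
    by rewrite ler_pM ?normc_ge0.
  rewrite (_ : C * _ * _ = C * M * (poisson_weight (x - y) * poisson_weight y) * poisson_weight y);
    last by ring.
  rewrite ler_wpM2r ?(ltW (poisson_weight_gt0 _)) // -[leRHS]mulrA ler_wpM2l ?mulr_ge0 //.
  exact: poisson_weight_shift.
have bounds x y : normc (f x y) <= a x * poisson_weight y.
  rewrite /f Normc.normcM /a.
  rewrite (_ : B * C * _ * _ * _ * _ = B * (C * M * 2 * poisson_weight x * poisson_weight y)); last by ring.
  by rewrite ler_pM ?normc_ge0.
transitivity (cintegral (fun x => cintegral (f x))).
  apply: eq_cintegral => x; rewrite fourier_multiplier // cintegralZ //.
  apply: (cL1_le _ (L1Zl _ L1_poisson_weight) (kernel_bound x)).
  apply: cmeasurableM => //; apply: cmeasurable_real.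
  by apply: (measurableT_comp measurable_lp_kernel); exact: measurable_funB.
rewrite (cintegral_Fubini mf (L1Zl _ L1_poisson_weight) L1_poisson_weight bounds).
apply: eq_cintegral => y; rewrite /lp_conv mulrC -cintegralZ; last exact: cL1_conv.
by apply: eq_cintegral => x; rewrite /f; ring.
Qed.

End fixed_multiplier.
End multiplier_convolution.

(** * Essential suprema *)

Section Linfty_bounds.
Context {R : realType}.
Local Notation mu := (@lebesgue_measure R).
Local Notation normc := (@Normc.normc R).
Implicit Types (F G psi : R -> R[i]) (u : distr R).

Lemma Linfty_fnorm_le F (B : R) : (forall x, normc (F x) <= B) ->
  (Linfty_fnorm F <= B%:E)%E.
Proof.
move=> FB; rewrite /Linfty_fnorm unlock; case: ifPn => _.
  by apply/ess_supP; apply: nearW => x /=; rewrite lee_fin ger0_norm ?normc_ge0.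
by rewrite lee_fin (le_trans _ (FB 0)) ?normc_ge0.
Qed.

Lemma represents_distr_of F u : bounded_measurable F ->
  (forall psi, schwartz psi -> u psi = distr_of F psi) -> represents F u.
Proof.
move=> [[F1 F2] [B FB]] uF; split => //; split => //.
by apply: le_lt_trans (Linfty_fnorm_le FB) _; rewrite ltry.
Qed.

Lemma Linfty_norm_ge0 u : (0 <= Linfty_norm u)%E.
Proof. by apply: le_ereal_inf_tmp => _ [F _ <-]; exact: Lnorm_ge0. Qed.

Lemma Linfty_norm_le u F (B : R) : bounded_measurable F ->
  (forall psi, schwartz psi -> u psi = distr_of F psi) ->
  (forall x, normc (F x) <= B) -> (Linfty_norm u <= B%:E)%E.
Proof.
move=> bF uF FB; apply: ge_ereal_inf; exists (Linfty_fnorm F).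
  by exists F => //; exact: represents_distr_of.
exact: Linfty_fnorm_le.
Qed.

Lemma Linfty_fnorm_ae F (c : R) : Linfty_fnorm F = c%:E ->
  {ae mu, forall x, normc (F x) <= c}.
Proof.
(* The interval [0, 1] has measure 1, so the line has positive measure and the norm is the essential
   supremum. *)
rewrite /Linfty_fnorm unlock ifT; last first.
  rewrite (@lt_le_trans _ _ (mu `[0%R, 1%R])) //.
    by rewrite lebesgue_measure_itv /= lte01 oppr0 adde0 lte01.
  by apply: le_measure; rewrite ?inE.
move=> h; have /ess_supP : (ess_sup mu (abse \o (EFin \o normc \o F)) <= c%:E)%E by rewrite h.
by apply: filterS => x /=; rewrite lee_fin ger0_norm ?normc_ge0.
Qed.

(** An arbitrary representative of a bounded distribution is bounded only almost everywhere; its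
    integrability against a weight is derived here together with the estimate. *)
Lemma L1_ae_le (f g : R -> R) : measurable_fun [set: R] f -> L1 g ->
  (forall x, 0 <= g x) -> {ae mu, forall x, `|f x| <= g x} ->
  L1 f /\ `|\int[mu]_x f x| <= \int[mu]_x g x.
Proof.
move=> mf ig g0 fg.
have le_int : (\int[mu]_x `|f x|%:E <= \int[mu]_x (g x)%:E)%E.
  apply: ae_ge0_le_integral => //.
  - by apply/measurable_EFinP; exact: measurableT_comp.
  - by move=> x _; rewrite lee_fin.
  - exact: measurable_int ig.
  - by apply: filterS fg; [exact: (ae_filter_ringOfSetsType mu)|move=> x h _; rewrite lee_fin].
have fi : L1 f.
  apply/integrableP; split; first exact/measurable_EFinP.
  by apply: le_lt_trans le_int _; rewrite -RintE // ltry.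
split=> //; apply: le_trans (le_normr_Rintegral _ fi) _ => //.
by rewrite -lee_fin !RintE //; exact: L1_norm.
Qed.

(* The weights chi (n x) concentrate at the origin as n grows. *)
Lemma bump_test_le (chi f g : R -> R) (c B : R) : 0 <= c -> even_bump chi ->
  (forall x, 0 <= chi x) -> chi 0 = 1 -> measurable_fun [set: R] f ->
  {ae mu, forall x, `|f x| <= c} -> continuous g -> (forall x, `|g x| <= B) ->
  (forall n : nat, \int[mu]_x (f x * chi (n.+1%:R * x)) = \int[mu]_x (g x * chi (n.+1%:R * x))) ->
  `|g 0| <= c.
Proof.
move=> c0 [A [m1 [m2 [d1 d2 c2 v e]]]] chi0 chi1 mf fc cg gB fg.
have cchi : continuous chi by move=> x; exact: is_derive_continuous (d1 x).
have L1chi := L1_compact cchi v.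
(* If chi had integral 0, its cosine transform would vanish identically,
   contradicting the inversion formula at 0. *)
have I0 : 0 < \int[mu]_x chi x.
  rewrite lt_neqAle Rintegral_ge0 // andbT; apply/negP => /eqP I0.
  have G0 z : cos_transform chi z = 0.
    apply/eqP; rewrite -normr_le0 I0.
    have mc : measurable_fun [set: R] (fun x => cos (z * x)).
      by apply: continuous_measurable_fun; exact: continuous_cosM.
    have [||||] := @L1_ae_le (fun x => cos (z * x) * chi x) chi => //.
    - by apply: measurable_funM => //; exact: continuous_measurable_fun.
    - by apply: nearW => x; rewrite normrM (ger0_norm (chi0 x)) ler_piMl // cos_max.
  have := cos_transform_inversion d1 d2 c2 v e 0.
  under eq_Rintegral do rewrite G0 mulr0.
  rewrite {1}/Rintegral integral0 /= chi1 mulr1 => /esym/eqP.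
  by rewrite mulf_eq0 pnatr_eq0 /= gt_eqF // pi_gt0.
have n0 (n : nat) : (0 : R) < n.+1%:R^-1 by rewrite invr_gt0.
have cchin (n : nat) : continuous (fun x : R => chi (n.+1%:R * x)).
  rewrite (_ : (fun x => _) = fun x => chi (0 + n.+1%:R * x)).
    exact: continuous_affine.
  by apply/funext => x; rewrite add0r.
have L1chin (n : nat) : L1 (fun x : R => chi (n.+1%:R * x)).
  apply: (@L1_compact _ _ (A / n.+1%:R) (cchin n)) => x Ax; apply: v.
  by rewrite normrM ger0_norm // mulrC -ltr_pdivrMr.
(* Rescaling the variable keeps the weight [chi] fixed and contracts the argument of [h] to 0
   instead. *)
have scale n (h : R -> R) : continuous h -> \int[mu]_x (h x * chi (n.+1%:R * x)) =
    n.+1%:R^-1 * \int[mu]_x (h (0 + n.+1%:R^-1 * x) * chi x).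
  move=> ch; rewrite -(@Rintegral_affine _ _ 0 n.+1%:R^-1) //; last exact: continuousMf.
  rewrite mulrC -RintegralZr.
    by apply: eq_Rintegral => x _; rewrite {2}add0r mulrA divff ?mul1r.
  - exact: measurableT.
  - apply: (@L1_compact _ _ A); first by apply: continuousMf => //; exact: continuous_affine.
    exact: vanishesM.
(* By [fg] the integral of [g] may be replaced by that of [f], to which the almost-everywhere bound
   [c] applies; the scaling factors on the two sides cancel. *)
have bound n : `|\int[mu]_x (g (0 + n.+1%:R^-1 * x) * chi x)| <= c * \int[mu]_x chi x.
  have := scale n _ cg; have := scale n (fun _ => c) (fun _ => cvg_cst _).
  rewrite -fg [in RHS]RintegralZl // => h1 h2.
  rewrite -(ler_pM2l (n0 n)) -h1 -{1}(gtr0_norm (n0 n)) -normrM -h2.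
  have [||//||_ //] := @L1_ae_le (fun x => f x * chi (n.+1%:R * x)) (fun x => c * chi (n.+1%:R * x)).
  - by apply: measurable_funM => //; exact: continuous_measurable_fun.
  - exact: L1Zl.
  - by move=> x; rewrite mulr_ge0.
  - apply: filterS fc; first exact: (ae_filter_ringOfSetsType mu).
    by move=> x h; rewrite normrM (ger0_norm (chi0 _)) ler_wpM2r.
have lim : \int[mu]_x (g (0 + n.+1%:R^-1 * x) * chi x) @[n --> \oo] --> \int[mu]_x (g 0 * chi x).
  apply: (@Rdominated_convergence _ _ _ (fun x => B * chi x)).
  - move=> n; apply: continuous_measurable_fun; apply: continuousMf => //.
    exact: continuous_affine.
  - by apply: continuous_measurable_fun; apply: continuousMf => // x; exact: cvg_cst.
  - exact: L1Zl.
  - by move=> n x; rewrite normrM (ger0_norm (chi0 x)) ler_wpM2r.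
  - move=> x; apply: cvgM; last exact: cvg_cst.
    suff h : 0 + n.+1%:R^-1 * x @[n --> \oo] --> (0 : R) by exact: (cvg_comp _ _ h (@cg 0)).
    rewrite -[X in _ --> X]addr0; apply: cvgD; first exact: cvg_cst.
    by rewrite -(mul0r x); apply: cvgM; [exact: cvg_harmonic|exact: cvg_cst].
rewrite RintegralZl // in lim.
have : `|g 0 * \int[mu]_x chi x| <= c * \int[mu]_x chi x.
  by apply: (cvgr_to_le (cvg_norm lim)); exact: nearW.
by rewrite normrM (gtr0_norm I0) ler_pM2r.
Qed.

End Linfty_bounds.

(** * Littlewood-Paley pairs *)

Section littlewood_paley.



Context {R : realType}.
Local Notation mu := (@lebesgue_measure R).
Local Notation normc := (@Normc.normc R).
Implicit Types f : R -> R.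

Lemma smooth_is_derive f n (x : R) : smooth f ->
  is_derive x 1 (derive1n n f) (derive1n n.+1 f x).
Proof. by move=> sf; rewrite derive1nS derive1E; apply: DeriveDef. Qed.

Lemma derive1n_scale f (c : R) n : smooth f ->
  derive1n n (fun x => f (c * x)) = fun x => c ^+ n * derive1n n f (c * x).
Proof.
move=> sf; elim: n => [|n IH]; first by apply/funext => x; rewrite mul1r.
apply/funext => x; rewrite derive1nS IH derive1E.
have d := is_derive1_comp (smooth_is_derive n (c * x) sf) (is_derive_scale c x).
have [_ ->] : is_derive x 1 (fun x => c ^+ n * derive1n n f (c * x))
    (c ^+ n.+1 * derive1n n.+1 f (c * x)).
  by apply: is_derive_eq; rewrite /GRing.scale /= exprS; ring.
by [].
Qed.

Lemma smooth_scale f (c : R) : smooth f -> smooth (fun x => f (c * x)).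
Proof.
move=> sf n x; rewrite derive1n_scale //.
have d := is_derive1_comp (smooth_is_derive n (c * x) sf) (is_derive_scale c x).
have [//] : is_derive x 1 (fun x => c ^+ n * derive1n n f (c * x))
    (c ^+ n.+1 * derive1n n.+1 f (c * x)).
by apply: is_derive_eq; rewrite /GRing.scale /= exprS; ring.
Qed.

Lemma vanishes_scale f (A c : R) : 0 < c -> vanishes_beyond A f ->
  vanishes_beyond (A / c) (fun x => f (c * x)).
Proof.
move=> c0 f0 x; rewrite ltr_pdivrMr // => Ax; apply: f0.
by rewrite normrM (gtr0_norm c0) mulrC.
Qed.

Lemma smooth_even_bump f (A : R) : smooth f -> vanishes_beyond A f ->
  (forall x, f (- x) = f x) -> even_bump f.
Proof.
move=> sf f0 ef; exists A, (derive1n 1 f), (derive1n 2 f); split; [| | |exact: f0|exact: ef].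
- by move=> x; exact: (smooth_is_derive 0 x sf).
- by move=> x; exact: (smooth_is_derive 1 x sf).
- by move=> x; exact: is_derive_continuous (smooth_is_derive 2 x sf).
Qed.

Lemma schwartz_bump f (A : R) : smooth f -> vanishes_beyond A f ->
  schwartz (fun x => (f x)%:C).
Proof.
move=> sf f0.
have d0 n : derive1n n (fun _ : R => 0 : R) = fun _ => 0.
  elim: n => // n IH; apply/funext => x.
  by rewrite derive1nS IH derive1E; apply: derive_val.
split=> //=; first by move=> n x; rewrite d0.
move=> k n.
have fn0 : vanishes_beyond A (derive1n n f).
  elim: n => // n IH; apply: (is_derive_vanishes IH) => x.
  exact: smooth_is_derive.
have [||B hB] := @vanishes_bounded _ A (fun x => `|x| ^+ k * derive1n n f x).
- apply: continuousMf => x.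
    apply: (@continuous_comp _ _ _ (fun x : R => `|x|) (fun y => y ^+ k)).
      exact: norm_continuous.
    exact: exprn_continuous.
  exact: is_derive_continuous (smooth_is_derive n x sf).
- exact: vanishesM.
exists B => x; rewrite /cderiv d0; apply: le_trans (hB x).
by rewrite expr0n addr0 sqrtr_sqr normrM normrX normr_id.
Qed.

Variables chi phi : R -> R.
Hypothesis hLP : littlewood_paley_pair chi phi.

Lemma chi_vanishes : vanishes_beyond (4 / 3) chi.
Proof.
by case: hLP => _ _ _ [h _] _ x; apply: contraTeq => /h; rewrite -leNgt.
Qed.

Lemma phi_vanishes : vanishes_beyond (8 / 3) phi.
Proof.
by case: hLP => _ _ _ [_ h] _ x; apply: contraTeq => /h /andP[_]; rewrite -leNgt.
Qed.

Lemma chi_even_bump : even_bump chi.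
Proof. by case: (hLP) => [[s _] [e _] _ _ _]; exact: smooth_even_bump chi_vanishes e. Qed.

Lemma pow2_gt0 j : (0 : R) < 2 ^- j.
Proof. by rewrite invr_gt0 exprn_gt0. Qed.

Lemma phi_even_bump j : even_bump (fun xi => phi (2 ^- j * xi)).
Proof.
case: (hLP) => [[_ s] [_ e] _ _ _].
have v := vanishes_scale (pow2_gt0 j) phi_vanishes.
apply: (smooth_even_bump _ v) => [|x]; first exact: smooth_scale.
by rewrite mulrN e.
Qed.

Lemma nneseries_single (u : nat -> \bar R) j : (forall i, i != j -> u i = 0%E) ->
  (\sum_(0 <= i <oo) u i = u j)%E.
Proof.
move=> u0; apply: lim_near_cst => //; exists j.+1 => // n /= jn.
rewrite big_mkord (bigD1 (Ordinal jn)) //= big1 ?adde0 // => i /eqP ij.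
by apply: u0; apply/eqP => e; apply: ij; exact: val_inj.
Qed.

Lemma phi0 : phi 0 = 0.
Proof.
case: hLP => _ _ _ [_ h] _; apply/eqP/negP => /negP /h /andP[].
by rewrite normr0 leNgt divr_gt0.
Qed.

Lemma chi0 : chi 0 = 1.
Proof.
case: (hLP) => _ _ _ _ /(_ 0).
(* Every term equals [phi 0], which is 0, so any index can play the distinguished one. *)
rewrite (@nneseries_single _ 0%N) => [|i _]; rewrite mulr0 phi0 //.
by rewrite adde0 => -[].
Qed.

(** * Shells on which exactly one cut-off is nonzero *)

Section plateau.
Variables (j : nat) (xi : R).
Hypothesis hxi : 4 / 3 * 2 ^+ j < `|xi| < 3 / 2 * 2 ^+ j.

(** For i < j the rescaled frequency exceeds 2 * 4/3 = 8/3, and for i > j it is below (3/2) / 2 =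
    3/4; both lie outside the support of [phi]. *)
Lemma phi_off_plateau i : i != j -> phi (2 ^- i * xi) = 0.
Proof.
move=> ij; case: hLP => _ _ _ [_ h] _; apply/eqP/negP => /negP /h.
rewrite normrM (gtr0_norm (pow2_gt0 i)) (mulrC (2 ^- i)) ler_pdivlMr ?exprn_gt0 //.
rewrite ler_pdivrMr ?exprn_gt0 // => /andP[h1 h2].
have [lo hi] := andP hxi.
case: (ltngtP i j) ij => // lt _.
  have p : 2 ^+ i * 2 <= 2 ^+ j :> R by rewrite -exprSr ler_eXn2l // ltr1n.
  have := lt_le_trans lo h2; lra.
have p : 2 ^+ j * 2 <= 2 ^+ i :> R by rewrite -exprSr ler_eXn2l // ltr1n.
have := le_lt_trans h1 hi; lra.
Qed.

Lemma chi_off_plateau : chi xi = 0.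
Proof.
apply: chi_vanishes; have [lo _] := andP hxi; apply: le_lt_trans lo.
by rewrite ler_peMr // exprn_ege1 // ler1n.
Qed.

(** All other terms of the partition of unity vanish at [xi], so the remaining one equals 1. *)
Lemma phi_on_plateau : phi (2 ^- j * xi) = 1.
Proof.
case: (hLP) => _ _ _ _ /(_ xi).
rewrite (@nneseries_single _ j) => [|i ij]; last by rewrite phi_off_plateau.
by rewrite chi_off_plateau add0e => -[].
Qed.

End plateau.

(** Any representative of [u] has the same integrals as [P] against the dilates of [chi]. As [chi]
    is real, real and imaginary parts can be tested separately, and [bump_test_le] bounds each of
    them at 0 by the norm; their sum accounts for the factor 2. *)
Lemma Linfty_norm_ge (u : distr R) (P : R -> R[i]) (a : R) : bounded_measurable P ->
  continuous (fun x => complex.Re (P x)) -> continuous (fun x => complex.Im (P x)) ->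
  (forall psi, schwartz psi -> u psi = distr_of P psi) ->
  a <= normc (P 0) -> (a%:E <= 2%:E * Linfty_norm u)%E.
Proof.
move=> [_ [B PB]] cRe cIm uP aP.
rewrite -lee_pdivrMl // -EFinM; apply: le_ereal_inf_tmp => _ [F [[mRe mIm Foo] uF] <-].
have F0 : (0 <= Linfty_fnorm F)%E by exact: Lnorm_ge0.
have Ffin : Linfty_fnorm F \is a fin_num by rewrite ge0_fin_numE.
rewrite -(fineK Ffin) lee_fin; set c := fine _.
have c0 : 0 <= c by rewrite fine_ge0.
have Fc : {ae mu, forall x, normc (F x) <= c} by apply: Linfty_fnorm_ae; rewrite fineK.
case: (hLP) => [[s _] [e _] [chi01 _] _ _].
have chi_ge0 x : 0 <= chi x by have /andP[] := chi01 x.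
pose t n x := (chi (n.+1%:R * x))%:C.
have n0 (n : nat) : (0 : R) < n.+1%:R by [].
have st n : schwartz (t n).
  apply: (schwartz_bump (f := fun x => chi (n.+1%:R * x)) _ (vanishes_scale (n0 n) chi_vanishes)).
  exact: smooth_scale.
have FP n : distr_of F (t n) = distr_of P (t n) by rewrite -uF // uP.
have hRe : `|complex.Re (P 0)| <= c.
  apply: (@bump_test_le _ chi (fun x => complex.Re (F x)) (fun x => complex.Re (P x)) c B) => //.
  - exact: chi_even_bump.
  - exact: chi0.
  - apply: filterS Fc; first exact: (ae_filter_ringOfSetsType mu).
    by move=> x; apply: le_trans; exact: le_Re_normc.
  - by move=> x; apply: le_trans (PB x); exact: le_Re_normc.
  - move=> n; have : \int[mu]_x complex.Re (F x * t n x) = \int[mu]_x complex.Re (P x * t n x).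
      exact: (congr1 (@complex.Re R) (FP n)).
    under eq_Rintegral do rewrite cReM mulr0 subr0.
    by under [in RHS]eq_Rintegral do rewrite cReM mulr0 subr0.
have hIm : `|complex.Im (P 0)| <= c.
  apply: (@bump_test_le _ chi (fun x => complex.Im (F x)) (fun x => complex.Im (P x)) c B) => //.
  - exact: chi_even_bump.
  - exact: chi0.
  - apply: filterS Fc; first exact: (ae_filter_ringOfSetsType mu).
    by move=> x; apply: le_trans; exact: le_Im_normc.
  - by move=> x; apply: le_trans (PB x); exact: le_Im_normc.
  - move=> n; have : \int[mu]_x complex.Im (F x * t n x) = \int[mu]_x complex.Im (P x * t n x).
      exact: (congr1 (@complex.Im R) (FP n)).
    under eq_Rintegral do rewrite cImM mulr0 add0r.
    by under [in RHS]eq_Rintegral do rewrite cImM mulr0 add0r.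
have := normc_le_ReIm (P 0).
by rewrite mulrC ler_pdivrMr //; lra.
Qed.

End littlewood_paley.

(** * Trigonometric polynomials *)

Section trigonometric_polynomials.
Context {R : realType}.
Local Notation normc := (@Normc.normc R).
Implicit Types (S : R -> Prop) (F G : R -> R[i]).

(** A frequency may occur several times, so a sum of two such polynomials is formed by mere
    concatenation. *)
Inductive trig_poly S : (R -> R[i]) -> Prop :=
| trig_poly0 : trig_poly S (fun _ => 0)
| trig_polyS c l F : S l -> trig_poly S F -> trig_poly S (fun x => c * cexp l x + F x).

Lemma trig_poly_sub S S' F : (forall l, S l -> S' l) -> trig_poly S F -> trig_poly S' F.
Proof.
move=> SS'; elim=> [|c l G Sl _ IH]; first exact: trig_poly0.
by apply: trig_polyS => //; exact: SS'.
Qed.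

Lemma trig_polyD S F G : trig_poly S F -> trig_poly S G -> trig_poly S (fun x => F x + G x).
Proof.
move=> tF tG; elim: tF => [|c l {}F Sl _ IH].
  by under eq_fun do rewrite add0r.
by under eq_fun do rewrite -addrA; exact: trig_polyS.
Qed.

Lemma trig_poly_modulate S S' c k F : (forall l, S l -> S' (k + l)) -> trig_poly S F ->
  trig_poly S' (fun x => c * cexp k x * F x).
Proof.
move=> SS'; elim=> [|d l G Sl _ IH].
  by under eq_fun do rewrite mulr0; exact: trig_poly0.
rewrite (_ : (fun x => _) = fun x => c * d * cexp (k + l) x + c * cexp k x * G x).
  by apply: trig_polyS => //; exact: SS'.
by apply/funext => x; rewrite -cexpM; ring.
Qed.

Lemma trig_poly_cexp S l : S l -> trig_poly S (cexp l).
Proof.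
move=> Sl; rewrite (_ : cexp l = fun x => 1 * cexp l x + 0).
  by apply: trig_polyS => //; exact: trig_poly0.
by apply/funext => x; rewrite mul1r addr0.
Qed.

Lemma trig_poly_bounded_measurable S F : trig_poly S F -> bounded_measurable F.
Proof.
elim=> [|c l G _ _ IH]; last exact: bounded_measurable_lin (bounded_measurable_cexp l) IH.
by split; [exact: cmeasurable_cst|exists 0 => x; rewrite Normc.normc0].
Qed.

Lemma trig_poly_continuous S F : trig_poly S F ->
  continuous (fun x => complex.Re (F x)) /\ continuous (fun x => complex.Im (F x)).
Proof.
elim=> [|c l G _ _ [IHr IHi]]; first by split=> x /=; exact: cvg_cst.
have cc (a : R) : continuous (fun _ : R => a) by move=> x; exact: cvg_cst.
have ck := @continuous_cosM R l; have sk := @continuous_sinM R l.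
split.
  under eq_fun do rewrite cReD cReM /=.
  apply: continuousDf => // x; apply: cvgB; [exact: (continuousMf (cc _) ck)|exact: (continuousMf (cc _) sk)].
under eq_fun do rewrite cImD cImM /=.
by apply: continuousDf => //; apply: continuousDf; apply: continuousMf.
Qed.

Lemma lp_conv_trig_poly m S F (k : R) : even_bump m -> trig_poly S F ->
  (forall l, S l -> m l = k) -> lp_conv m F = fun y => k%:C * F y.
Proof.
move=> bm tF mS; elim: tF => [|c l G Sl tG IH]; apply/funext => y.
  (* The convolution of the zero function is computed from linearity: with coefficient -1 it equals
     minus itself plus itself. *)
  have b0 := trig_poly_bounded_measurable (trig_poly0 S).
  have := congr1 (fun f => f y) (lp_conv_lin bm (-1) b0 b0).
  rewrite (_ : (fun x : R => -1 * 0 + 0) = fun _ => 0); last first.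
    by apply/funext => x; rewrite mulr0 addr0.
  by rewrite mulN1r addNr mulr0.
rewrite (lp_conv_lin bm c (bounded_measurable_cexp l) (trig_poly_bounded_measurable tG)) IH.
by rewrite (lp_conv_cexp bm) mS //; ring.
Qed.

Lemma multiplier_trig_poly m S F (k : R) psi : even_bump m -> trig_poly S F ->
  (forall l, S l -> m l = k) -> schwartz psi ->
  multiplier m (distr_of F) psi = distr_of (fun y => k%:C * F y) psi.
Proof.
move=> bm tF mS sp; rewrite (multiplier_distr_of bm (trig_poly_bounded_measurable tF) sp).
by rewrite (lp_conv_trig_poly bm tF mS).
Qed.

Lemma multiplier_norm_le m S F (k B : R) : even_bump m -> trig_poly S F ->
  (forall l, S l -> m l = k) -> (forall x, normc (F x) <= B) ->
  (Linfty_norm (multiplier m (distr_of F)) <= (`|k| * B)%:E)%E.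
Proof.
move=> bm tF mS FB; apply: (@Linfty_norm_le _ _ (fun y => k%:C * F y)).
- have := bounded_measurable_lin k%:C (trig_poly_bounded_measurable tF)
    (trig_poly_bounded_measurable (trig_poly0 S)).
  by under eq_fun do rewrite addr0.
- by move=> psi sp; exact: multiplier_trig_poly mS sp.
- by move=> x; rewrite Normc.normcM normc_real ler_wpM2l.
Qed.

(** * Bounded functions are tempered distributions *)

Lemma schwartz_seminorm_le (psi : R -> R[i]) (k n : nat) x : schwartz psi ->
  `|x| ^+ k * normc (cderiv n psi x) <=
  sup (range (fun x : R => `|x| ^+ k * normc (cderiv n psi x))).
Proof.
move=> [_ _ /(_ k n)[M hM]]; apply: ub_le_sup; last by exists x.
by exists M => _ [y _ <-].
Qed.

Lemma schwartz_seminorm_ge0 (psi : R -> R[i]) (k n : nat) : schwartz psi ->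
  0 <= sup (range (fun x : R => `|x| ^+ k * normc (cderiv n psi x))).
Proof.
move=> sp; apply: le_trans (schwartz_seminorm_le k n 0 sp).
by rewrite mulr_ge0 // normc_ge0.
Qed.

Lemma le_corner_sum (s : nat -> nat -> R) : (forall k n, 0 <= s k n) ->
  s 0 0 + s 2 0 <= \sum_(k < 3) \sum_(n < 3) s k n.
Proof.
move=> s0; apply: (@le_trans _ _ (\sum_(k < 3) s k 0)).
  by rewrite !big_ord_recr big_ord0 /= add0r -addrA lerD2l lerDr.
apply: ler_sum => k _; rewrite (bigD1 ord0) //= lerDl.
by apply: sumr_ge0.
Qed.

(** The seminorms with (k, n) = (0, 0) and (2, 0) control (1 + x^2) |psi(x)|, and both occur in the
    sum defining [schwartz_norm 2]. *)
Lemma schwartz_norm2_decay psi x : schwartz psi ->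
  normc (psi x) <= schwartz_norm 2 psi * poisson_weight x.
Proof.
move=> sp; rewrite ler_pdivlMr ?ltr_pwDl ?sqr_ge0 // mulrDr mulr1 /schwartz_norm.
have cd0 : cderiv 0 psi x = psi x by rewrite /cderiv /=; case: (psi x).
have := schwartz_seminorm_le 0 0 x sp; have := schwartz_seminorm_le 2 0 x sp.
rewrite cd0 expr0 mul1r mulrC real_normK ?num_real //.
move=> h2 h0; apply: le_trans (lerD h0 h2) _.
exact: (le_corner_sum (fun k n => schwartz_seminorm_ge0 k n sp)).
Qed.

Lemma tempered_distr_of F : bounded_measurable F -> tempered (distr_of F).
Proof.
move=> bF; split=> [a p1 p2 s1 s2|].
  have i1 := cL1_schwartz bF s1; have i2 := cL1_schwartz bF s2.
  rewrite /distr_of -cintegralZ // -cintegralD //; last exact: cL1Z.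
  by apply: eq_cintegral => x; ring.
have [_ [B FB]] := bF.
have B0 : 0 <= B by apply: le_trans (FB 0); exact: normc_ge0.
(* The real and the imaginary part each contribute B times the Schwartz norm times pi, the integral
   of the weight. *)
exists 2%N, (2 * B * pi) => psi sp.
set s := schwartz_norm 2 psi.
pose g x := B * s * poisson_weight x.
have ig : L1 g by exact: L1Zl L1_poisson_weight.
have Fg x : normc (F x * psi x) <= g x.
  rewrite Normc.normcM /g -mulrA ler_pM ?normc_ge0 //.
  exact: schwartz_norm2_decay.
have Ig : \int[lebesgue_measure]_x g x = B * s * pi.
  by rewrite RintegralZl //; [rewrite /Rintegral integral_poisson_weight|exact: L1_poisson_weight].
have [L1r L1i] := cL1_schwartz bF sp.
have bound (f : R -> R) : L1 f -> (forall x, `|f x| <= normc (F x * psi x)) ->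
    `|\int[lebesgue_measure]_x f x| <= B * s * pi.
  move=> fi fF; rewrite -Ig; apply: le_trans (le_normr_Rintegral _ fi) _ => //.
  apply: le_Rintegral => //; first exact: L1_norm.
  by move=> x _; exact: le_trans (fF x) (Fg x).
apply: (@le_trans _ _ (B * s * pi + B * s * pi)); last by rewrite le_eqVlt; apply/orP; left; apply/eqP; ring.
apply: le_trans (lerD (bound _ L1r (fun x => le_Re_normc _)) (bound _ L1i (fun x => le_Im_normc _))).
rewrite /distr_of /cintegral; exact: normc_le_ReIm.
Qed.

End trigonometric_polynomials.

(** * Riesz products *)

Section riesz_product.
Context {R : realType}.
Local Notation normc := (@Normc.normc R).

(** 17/12 is the midpoint of 4/3 and 3/2, leaving a margin of 1/12 on either side in units of
    2^(5j). Consecutive frequencies have ratio 32. *)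
Definition riesz_freq (j : nat) : R := 17 / 12 * 2 ^+ (5 * j).

(** The bound 1/16 is below the margin 1/12, so adding such an [l] to a frequency of modulus
    [riesz_freq j] stays in the shell. At the next stage it becomes 32/16 = 2 in the old units,
    above the 3/2 that bounds the shell, so the induction closes. *)
Definition low_freq (j : nat) (l : R) : Prop := `|l| <= 2 ^+ (5 * j) / 16.

Definition plateau (j : nat) (l : R) : Prop := 4 / 3 * 2 ^+ j < `|l| < 3 / 2 * 2 ^+ j.

Variable a : R.

(** Being purely imaginary, it raises the modulus of [1 + riesz_factor j x] above 1 only to second
    order in [a], while the blocks themselves are of first order. *)
Definition riesz_factor (j : nat) (x : R) : R[i] := 0 +i* (a * cos (riesz_freq j * x)).

Fixpoint riesz (j : nat) (x : R) : R[i] :=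
  if j is i.+1 then riesz i x * (1 + riesz_factor i x) else 1.

Definition riesz_block (j : nat) (x : R) : R[i] := riesz_factor j x * riesz j x.

(** The factor 1 puts the recursion in the form a F + G to which the linearity of [lp_conv]
    applies. *)
Lemma rieszS j x : riesz j.+1 x = 1 * riesz_block j x + riesz j x.
Proof. by rewrite /riesz_block /=; ring. Qed.

Lemma riesz_factorE j x : riesz_factor j x =
  (0 +i* (a / 2)) * cexp (riesz_freq j) x + (0 +i* (a / 2)) * cexp (- riesz_freq j) x.
Proof.
apply/eqP; rewrite eq_complex cReD cImD !cReM !cImM /riesz_factor /cexp /= mulNr cosN sinN.
by apply/andP; split; apply/eqP; field.
Qed.

Lemma plateau_shift j k l : `|k| = riesz_freq j -> low_freq j l -> plateau (5 * j) (k + l).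
Proof.
rewrite /low_freq /plateau /riesz_freq => kE lj.
have p : (0 : R) < 2 ^+ (5 * j) by rewrite exprn_gt0.
have := lerB_normD k l; have := ler_normD k l; rewrite kE => h1 h2.
by apply/andP; split; lra.
Qed.

Lemma low_freqS j l : low_freq j l -> low_freq j.+1 l.
Proof.
rewrite /low_freq mulnS exprD => h.
have p : (0 : R) < 2 ^+ (5 * j) by rewrite exprn_gt0.
by rewrite (_ : 2 ^+ 5 = 32 :> R); [lra|rewrite -natrX].
Qed.

Lemma plateau_low_freq j l : plateau (5 * j) l -> low_freq j.+1 l.
Proof.
rewrite /low_freq /plateau mulnS exprD => /andP[_ h].
have p : (0 : R) < 2 ^+ (5 * j) by rewrite exprn_gt0.
by rewrite (_ : 2 ^+ 5 = 32 :> R); [lra|rewrite -natrX].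
Qed.

Lemma riesz_freq_gt0 j : 0 < riesz_freq j.
Proof. by rewrite mulr_gt0 ?exprn_gt0 // divr_gt0. Qed.

(** Each half of the cosine translates the low spectrum into the shell. The spectrum of [riesz j] is
    a hypothesis so that this can be used inside the induction establishing it. *)
Lemma trig_poly_riesz_block_of j : trig_poly (low_freq j) (riesz j) ->
  trig_poly (plateau (5 * j)) (riesz_block j).
Proof.
move=> tj; rewrite /riesz_block.
rewrite (_ : (fun x => _) = fun x =>
    (0 +i* (a / 2)) * cexp (riesz_freq j) x * riesz j x +
    (0 +i* (a / 2)) * cexp (- riesz_freq j) x * riesz j x).
  have f0 := ltW (riesz_freq_gt0 j).
  by apply: trig_polyD; apply: (trig_poly_modulate _ _ tj) => l;
    apply: plateau_shift; rewrite ?normrN ger0_norm.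
by apply/funext => x; rewrite riesz_factorE; ring.
Qed.

Lemma trig_poly_riesz j : trig_poly (low_freq j) (riesz j).
Proof.
elim: j => [|j IH].
  rewrite (_ : riesz 0 = cexp 0); last first.
    by apply/funext => x; rewrite /cexp mul0r cos0 sin0.
  by apply: trig_poly_cexp; rewrite /low_freq normr0 divr_ge0 // exprn_ge0.
rewrite (_ : riesz j.+1 = fun x => riesz_block j x + riesz j x); last first.
  by apply/funext => x; rewrite rieszS mul1r.
apply: trig_polyD; last exact: trig_poly_sub (@low_freqS j) IH.
exact: trig_poly_sub (@plateau_low_freq j) (trig_poly_riesz_block_of IH).
Qed.

Lemma trig_poly_riesz_block j : trig_poly (plateau (5 * j)) (riesz_block j).
Proof. exact: trig_poly_riesz_block_of (trig_poly_riesz j). Qed.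

(** Each factor has modulus at most sqrt(1 + a^2), hence at most 1 + a^2 and so at most exp(a^2). *)
Lemma riesz_le j x : normc (riesz j x) <= expR (a ^+ 2 *+ j).
Proof.
elim: j => [|j IH]; first by rewrite mulr0n expR0 [riesz _ _]/= Normc.normc1.
rewrite mulrSr expRD [riesz _ _]/= Normc.normcM ler_pM ?normc_ge0 //.
apply: le_trans (expR_ge1Dx _); rewrite /riesz_factor; simpc => /=.
rewrite -[leRHS]ger0_norm ?addr_ge0 ?sqr_ge0 // -sqrtr_sqr ler_wsqrtr //.
rewrite expr1n exprMn sqrrD expr1n mul1r -addrA lerD2l.
have c1 : cos (riesz_freq j * x) ^+ 2 <= 1 by rewrite -(cos2Dsin2 (riesz_freq j * x)) lerDl sqr_ge0.
have := sqr_ge0 a => a2; rewrite mulr2n.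
apply: (@le_trans _ _ (a ^+ 2)); first by rewrite ler_piMr.
by rewrite -addrA lerDl addr_ge0 // sqr_ge0.
Qed.

Lemma riesz0_ge1 j : 1 <= normc (riesz j 0).
Proof.
elim: j => [|j IH]; first by rewrite [riesz _ _]/= Normc.normc1.
rewrite [riesz _ _]/= Normc.normcM mulr_ege1 //.
(* The new factor has real part 1, hence modulus at least 1. *)
by apply: le_trans (le_Re_normc _); rewrite cReD /= addr0 normr1.
Qed.

Lemma riesz_block0_ge j : a <= normc (riesz_block j 0).
Proof.
rewrite /riesz_block Normc.normcM /riesz_factor mulr0 cos0 mulr1.
rewrite (_ : normc _ = `|a|); last by rewrite /= expr0n add0r sqrtr_sqr.
by apply: le_trans (ler_norm a) _; rewrite ler_peMr // riesz0_ge1.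
Qed.

(** * Besov norms of shell-supported polynomials and of Riesz products *)

Variables chi phi : R -> R.
Hypothesis hLP : littlewood_paley_pair chi phi.

Lemma besov_norm_plateau j F (B : R) : trig_poly (plateau j) F ->
  (forall x, normc (F x) <= B) -> (besov_norm chi phi (distr_of F) <= B%:E)%E.
Proof.
move=> tF FB.
have norm0 m : even_bump m -> (forall l, plateau j l -> m l = 0) ->
    Linfty_norm (multiplier m (distr_of F)) = 0%E.
  move=> bm m0; apply/eqP; rewrite eq_le Linfty_norm_ge0 andbT.
  by have := multiplier_norm_le bm tF m0 FB; rewrite normr0 mul0r.
have L0 : Linfty_norm (lowfreq_block chi (distr_of F)) = 0%E.
  by apply: norm0 => [|l hl]; [exact: (chi_even_bump hLP)|exact: (chi_off_plateau hLP hl)].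
pose u i := Linfty_norm (dyadic_block phi i (distr_of F)).
have Lj : (\sum_(0 <= i <oo) u i = u j)%E.
  apply: nneseries_single => i ij.
  by apply: norm0 => [|l hl]; [exact: (phi_even_bump hLP)|exact: (phi_off_plateau hLP hl)].
have -> : besov_norm chi phi (distr_of F) = (0 + u j)%E by exact: congr2 L0 Lj.
rewrite add0e.
have := multiplier_norm_le (phi_even_bump hLP j) tF (k := 1) _ FB.
by rewrite normr1 mul1r; apply=> l hl; exact: (phi_on_plateau hLP hl).
Qed.

Lemma besov_plateau j F (B : R) : trig_poly (plateau j) F ->
  (forall x, normc (F x) <= B) -> besov chi phi (distr_of F).
Proof.
move=> tF FB; split; first exact: tempered_distr_of (trig_poly_bounded_measurable tF).
by apply: le_lt_trans (besov_norm_plateau tF FB) _; rewrite ltry.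
Qed.

(** The cut-off of index 5j is 1 on the spectrum of block j and 0 on those of all other blocks, and
    it kills the constant 1 because [phi 0] is 0. The induction adds one block at a time. *)
Lemma lp_conv_riesz i j :
  lp_conv (fun xi => phi (2 ^- (5 * j) * xi)) (riesz i) =
  if (j < i)%N then riesz_block j else fun _ => 0.
Proof.
have bm := phi_even_bump hLP (5 * j).
elim: i => [|i IH].
  have t0 : trig_poly (eq 0) (riesz 0).
    rewrite (_ : riesz 0 = cexp 0); first exact: trig_poly_cexp.
    by apply/funext => x; rewrite /cexp mul0r cos0 sin0.
  rewrite (lp_conv_trig_poly bm t0 (k := 0)).
    by apply/funext => y; rewrite mul0r.
  by move=> _ <-; rewrite mulr0 (phi0 hLP).
rewrite (_ : riesz i.+1 = fun x => 1 * riesz_block i x + riesz i x); last first.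
  by apply/funext => x; rewrite rieszS.
have tb := trig_poly_riesz_block i.
rewrite (lp_conv_lin bm) ?IH; [|exact: trig_poly_bounded_measurable tb|
  exact: trig_poly_bounded_measurable (trig_poly_riesz i)].
rewrite (lp_conv_trig_poly bm tb (k := (i == j)%:R)); last first.
  move=> l hl; have [<-|ij] := eqVneq i j; first exact: (phi_on_plateau hLP hl).
  by apply: (phi_off_plateau hLP hl); rewrite eqn_pmul2l // eq_sym.
apply/funext => y; case: (eqVneq i j) => [->|ij].
  by rewrite ltnSn ltnn /= mulr1n !mul1r addr0.
have -> : (j < i.+1)%N = (j < i)%N by rewrite ltnS leq_eqVlt eq_sym (negPf ij).
by rewrite mulr0n mul0r mulr0 add0r.
Qed.

Lemma riesz_block_norm_ge N j : (j < N)%N ->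
  (a%:E <= 2%:E * Linfty_norm (dyadic_block phi (5 * j) (distr_of (riesz N))))%E.
Proof.
move=> jN; have tb := trig_poly_riesz_block j; have [cr ci] := trig_poly_continuous tb.
apply: (Linfty_norm_ge hLP (trig_poly_bounded_measurable tb) cr ci) => [psi sp|].
  have bN := trig_poly_bounded_measurable (trig_poly_riesz N).
  by rewrite /dyadic_block (multiplier_distr_of (phi_even_bump hLP _) bN sp) lp_conv_riesz jN.
exact: riesz_block0_ge.
Qed.

Lemma besov_norm_riesz_ge N :
  ((N%:R * (a / 2))%:E <= besov_norm chi phi (distr_of (riesz N)))%E.
Proof.
pose u i := Linfty_norm (dyadic_block phi i (distr_of (riesz N))).
have u0 i : (0 <= u i)%E by exact: Linfty_norm_ge0.
(* Among each five consecutive dyadic indices only the first, a multiple of 5, is bounded below; the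
   other four contribute nonnegative terms. *)
have partial J : (J <= N)%N -> ((J%:R * (a / 2))%:E <= \sum_(0 <= i < 5 * J) u i)%E.
  elim: J => [|J IH] JN; first by rewrite muln0 big_nil mul0r.
  rewrite (@big_cat_nat _ _ _ (5 * J)) //=; last by rewrite leq_mul2l leqnSn orbT.
  rewrite -natr1 mulrDl mul1r EFinD leeD ?IH ?(ltnW JN) //.
  rewrite big_ltn; last by rewrite ltn_pmul2l.
  rewrite -[leLHS]adde0 leeD ?sume_ge0 //.
  rewrite mulrC EFinM lee_pdivrMl //; exact: riesz_block_norm_ge.
apply: le_trans (partial N (leqnn N)) _.
rewrite /besov_norm -[leLHS]add0e leeD ?Linfty_norm_ge0 //.
exact: nneseries_lim_ge.
Qed.

End riesz_product.

(** * Refutation of the product estimate *)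

Theorem lemma4p1 (R : realType) (chi phi : R -> R)
    (hLP : littlewood_paley_pair chi phi) :
  ~ (exists C : R, 0 < C /\
      forall f g fg : distr R,
        besov chi phi f -> besov chi phi g -> pointwise_product f g fg ->
        (besov_norm chi phi fg
           <= C%:E * besov_norm chi phi f * besov_norm chi phi g)%E).
Proof.
case=> C [C0 hC].
(* The estimate will give (n + 1) / 2 <= C e, and this [n] satisfies n + 1 > 2 C e. The choice of
   [a] and [N] makes N a^2 = 1, which keeps the product bounded by e, while N a / 2 = (n + 1) /
   2. *)
pose n := Num.truncn (2 * C * expR 1).
pose a : R := n.+1%:R^-1; pose N := (n.+1 ^ 2)%N.
(* Modulation by [riesz_freq N] carries the whole low spectrum of the product into the single shell
   of index 5N; the opposite exponential [G] lies in that shell too and undoes the modulation. *)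
pose F x := 1 * cexp (riesz_freq N) x * riesz a N x.
pose G := cexp (- riesz_freq N : R).
have f0 := ltW (riesz_freq_gt0 N : 0 < riesz_freq N :> R).
have tF : trig_poly (plateau (5 * N)) F.
  apply: (trig_poly_modulate _ _ (trig_poly_riesz a N)) => l; apply: plateau_shift.
  by rewrite ger0_norm.
have tG : trig_poly (plateau (5 * N)) G.
  apply: trig_poly_cexp; rewrite -[- _]addr0; apply: plateau_shift.
    by rewrite normrN ger0_norm.
  by rewrite /low_freq normr0 divr_ge0 // exprn_ge0.
have FB x : Normc.normc (F x) <= expR 1.
  rewrite /F mul1r Normc.normcM normc_cexp mul1r (le_trans (riesz_le a N x)) //.
  by rewrite ler_expR -mulr_natr /a /N natrX exprVn mulVf // expf_neq0.
have GB x : Normc.normc (G x) <= 1 by rewrite normc_cexp.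
have FG : (fun x => F x * G x) = riesz a N.
  apply/funext => x; rewrite /F /G mul1r mulrAC cexpM subrr /cexp mul0r cos0 sin0.
  by rewrite (_ : 1 +i* 0 = 1) // mul1r.
have := hC (distr_of F) (distr_of G) (distr_of (fun x => F x * G x))
  (besov_plateau hLP tF FB) (besov_plateau hLP tG GB).
have pw : pointwise_product (distr_of F) (distr_of G) (distr_of (fun x => F x * G x)).
  exists F, G; split.
  - by apply: represents_distr_of => //; exact: trig_poly_bounded_measurable tF.
  - by apply: represents_distr_of => //; exact: trig_poly_bounded_measurable tG.
  - by [].
move=> /(_ pw); rewrite FG => h.
have Bnn u : (0 <= besov_norm chi phi u)%E.
  rewrite /besov_norm adde_ge0 ?Linfty_norm_ge0 // nneseries_ge0 // => *.
  exact: Linfty_norm_ge0.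
(* The lower bound for the Besov norm of the product meets the assumed estimate, in which the two
   factors contribute at most e and 1. *)
have : ((N%:R * (a / 2))%:E <= (C * expR 1 * 1)%:E)%E.
  apply: le_trans (besov_norm_riesz_ge a hLP N) _; apply: le_trans h _.
  rewrite EFinM lee_pmul ?mule_ge0 ?lee_fin ?(ltW C0) //.
    rewrite EFinM lee_pmul ?lee_fin ?(ltW C0) //; exact: besov_norm_plateau tF FB.
  exact: besov_norm_plateau tG GB.
rewrite lee_fin mulr1 /N natrX /a.
have -> : n.+1%:R ^+ 2 * (n.+1%:R^-1 / 2) = n.+1%:R / 2 :> R.
  by rewrite expr2 mulrA mulfK ?pnatr_eq0.
rewrite ler_pdivrMr // leNgt mulrC mulrA => /negP; apply.
by rewrite truncnS_gt.
Qed.
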